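(* Let $X\sim\mathrm{CO}(\mu;q)$ with $q(j)=\delta j^2+\beta j+\gamma$ and pmf $p$, let $S$ be its support and $M=|S|-1\in\{0,1,\ldots\}\cup\{\infty\}$, and let $g\colon S\to\mathbb R$. Fix an integer $k$ with $1\le k\le M$, assume that $\mathbb E|X|^{2k+1}<\infty$, and consider the random variables $X_i$, $i=0,1,\ldots,k$, with pmfs $p_i\propto q^{[i]}p$. Then: (a) The Fourier coefficients satisfy the relation $$\mathbb E[\phi_{k-i,i}(X_i)\,\Delta^i g(X_i)]=v^{(i)}_{k-i}\,\mathbb E[\phi_k(X)g(X)],\qquad i=0,1,\ldots,k,$$ where $v^{(i)}_{k-i}=\left\{\dfrac{k!\,\Pi_\delta^{[i]}(k-1)}{(k-i)!\,\mathbb E[q^{[i]}(X)]}\right\}^{1/2}$. (b) If, in addition, $X\in\mathcal X$ (i.e. $\delta\le0$ or $S$ is finite) and $\Delta^n g\in L^2(\mathbb R,X_n)$ for some fixed integer $n$ with $1\le n\le M$, then, with $\alpha_k=\mathbb E[\phi_k(X)g(X)]$, $$\mathbb E\{q^{[i]}(X)[\Delta^i g(X)]^2\}=\sum_{k=i}^{M}\frac{k!\,\Pi_\delta^{[i]}(k-1)}{(k-i)!}\,\alpha_k^2\qquad\text{for all } i=0,1,\ldots,n.$$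
   Context: An integer-valued random variable $X$ with finite mean $\mu$ and pmf $p$ satisfies $X\sim\mathrm{CO}(\mu;q)$ (Cumulative Ord family), with $q(j)=\delta j^2+\beta j+\gamma$ a real polynomial of degree at most two, if $\sum_{k\le j}(\mu-k)p(k)=q(j)p(j)$ for all $j\in\mathbb Z$. Its support $S=\{j:p(j)>0\}$ is a set of consecutive integers $\{\alpha,\ldots,\omega\}$ ($\alpha,\omega$ possibly infinite). If $\delta\le 0$ or $S$ is finite, all moments of $X$ are finite. Notation: $h\in L^2(\mathbb R,Y)$ means $\mathbb E[h(Y)^2]<\infty$; $\Delta f(j)=f(j+1)-f(j)$, $\Delta^k$ its iterates; $f^{[k]}(x)=f(x)\cdots f(x+k-1)$, $f^{[0]}=1$; $\Pi_\delta^{[k]}(m)=\prod_{j=m}^{k+m-1}(1-j\delta)$, $\Pi_\delta^{[0]}(m)=1$; $c_k(\delta)=\Pi_\delta^{[k]}(k-1)$; $A_k(\mu;q)=\mathbb E[q^{[k]}(X)]$. If $\omega<\infty$, $q^{[i]}(j)=0$ for $j\in S$, $j>\omega-i$, so values of $g$ outside $S$ are irrelevant. Rodrigues polynomials: for $j\in S$, $P_k(j)=\frac{(-1)^k}{p(j)}\Delta^k\big[q^{[k]}(j-k)p(j-k)\big]$ (difference in $j$), and $\phi_k=[k!\,c_k(\delta)A_k(\mu;q)]^{-1/2}P_k$. The random variable $X_i$ has pmf $p_i\propto q^{[i]}p$ and support $\{\alpha,\ldots,\omega-i\}$; $q_i(j)=q(j+i)/(1-2i\delta)$, $\delta_i=\delta/(1-2i\delta)$,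 $\mu_i=(\delta i^2+\beta i+\mu)/(1-2i\delta)$; $P_{k,i}(j)=\frac{(-1)^k}{p_i(j)}\Delta^k\big[q_i^{[k]}(j-k)p_i(j-k)\big]$ and $\phi_{k,i}=[k!\,c_k(\delta_i)A_k(\mu_i;q_i)]^{-1/2}P_{k,i}$ with $A_k(\mu_i;q_i)=\mathbb E[q_i^{[k]}(X_i)]$; in particular $\phi_{0,i}\equiv1$ and $\phi_{k,0}=\phi_k$. *)

(* Defs.v *)
From HB Require Import structures.
From mathcomp Require Import all_boot all_order all_algebra.
From mathcomp Require Import all_classical all_reals all_analysis.

Set Implicit Arguments.
Unset Strict Implicit.
Unset Printing Implicit Defensive.

Import Order.TTheory GRing.Theory Num.Theory.
Import numFieldNormedType.Exports.

Local Open Scope classical_set_scope.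
Local Open Scope ring_scope.

(* [int] with its discrete sigma-algebra, so that [{RV P >-> int}] is the type
   of integer-valued random variables. *)
HB.instance Definition _ := isPointed.Build int 0.
HB.instance Definition _ := @isMeasurable.Build default_measure_display
  int (@discrete_measurable int) (@discrete_measurable0 int)
  (@discrete_measurableC int) (@discrete_measurableU int).

Section finite_calculus.
Variable R : realType.

Definition fdiff (f : int -> R) : int -> R := fun j => f (j + 1) - f j.

Definition fdiffn (k : nat) (f : int -> R) : int -> R := iter k fdiff f.

(* f^{[k]}(x) = f(x) f(x+1) ... f(x+k-1) *)
Definition rising (k : nat) (f : int -> R) : int -> R :=
  fun x => \prod_(l < k) f (x + l%:Z).

(* \Pi_delta^{[k]}(m) = \prod_{j=m}^{k+m-1} (1 - j delta) *)
Definition Pi_ (delta : R) (k m : nat) : R :=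
  \prod_(m <= j < k + m) (1 - j%:R * delta).

(* For k = 0 the truncated predecessor is harmless: the product is empty. *)
Definition c_ (delta : R) (k : nat) : R := Pi_ delta k k.-1.

Definition quad (delta beta gamma : R) : int -> R :=
  fun j => delta * j%:~R ^+ 2 + beta * j%:~R + gamma.

(* Meaningful where p j != 0 (elsewhere the value is 0). *)
Definition rodrigues (p q : int -> R) (k : nat) : int -> R := fun j =>
  (-1) ^+ k / p j
  * fdiffn k (fun l => rising k q (l - k%:Z) * p (l - k%:Z)) j.

Definition delta_ (delta : R) (i : nat) : R := delta / (1 - 2 * i%:R * delta).

Definition q_ (delta : R) (q : int -> R) (i : nat) : int -> R :=
  fun j => q (j + i%:Z) / (1 - 2 * i%:R * delta).

End finite_calculus.

Section integer_valued.
Context d (T : measurableType d) (R : realType) (P : probability T R).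
Implicit Types (X : {RV P >-> int}) (q h : int -> R).

Definition ipmf X (j : int) : R := fine (P (X @^-1` [set j])).

Definition supp X : set int := [set j | 0 < ipmf X j].

Definition Ex X h : \bar R := ('E_P[(fun t => h (X t))])%E.

Definition has_Ex X h : Prop :=
  P.-integrable [set: T] (fun t => (h (X t))%:E).

Definition in_L2 X h : Prop := (Ex X (fun j => (h j ^+ 2)%R) < +oo)%E.

(* The sum over all integers l <= j is enumerated as l = j - n, n = 0, 1, ... *)
Definition CO X (mu : R) q : Prop :=
  [/\ has_Ex X (fun j => j%:~R),
      Ex X (fun j => j%:~R) = mu%:E
    & forall j : int,
        series (fun n : nat => (mu - (j - n%:Z)%:~R) * ipmf X (j - n%:Z))
          @ \oo --> q j * ipmf X j].

(* k <= M, where M = |S| - 1 is possibly infinite: S has at least k + 1 points. *)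
Definition leM (k : nat) X : Prop := (`I_k.+1 #<= supp X)%card.

Definition A_ X q (k : nat) : R := fine (Ex X (rising k q)).

Definition phi X (delta : R) q (k : nat) : int -> R := fun j =>
  (Num.sqrt (k`!%:R * c_ delta k * A_ X q k))^-1 * rodrigues (ipmf X) q k j.

(* Functions on the support S are represented by arbitrary extensions to [int];
   the expectations used do not depend on the values outside S. *)
Definition alpha X (delta : R) q (g : int -> R) (k : nat) : R :=
  fine (Ex X (fun j => phi X delta q k j * g j)).

End integer_valued.

(* The pmf of [Xi] is proportional to q^{[i]} p, with p the pmf of [X]; the
   constant is forced by normalization. *)
Definition pmf_prop (R : realType) d (T : measurableType d)
    (P : probability T R) (X : {RV P >-> int}) (q : int -> R) (i : nat)
    d' (T' : measurableType d') (P' : probability T' R)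
    (Xi : {RV P' >-> int}) : Prop :=
  exists c : R, forall j : int, ipmf Xi j = c * (rising i q j * ipmf X j).

(* v^{(i)}_{k-i}, only used for i <= k *)
Definition v_ (R : realType) d (T : measurableType d) (P : probability T R)
    (X : {RV P >-> int}) (delta : R) (q : int -> R) (k i : nat) : R :=
  Num.sqrt (k`!%:R * Pi_ delta i k.-1 / ((k - i)`!%:R * A_ X q i)).

(* Main.v *)
(* With [w_i = q^{[i]} p], the recurrence satisfied by [p] gives, for every
   polynomial [u], [(u w_{i+1})(j - 1) - (u w_{i+1})(j) = (D_i u)(j) w_i(j)]
   with [D_i u] a polynomial of degree one more; hence the Rodrigues functions are
   polynomials [R_{m,i}] with [R_{m+1,i} = D_i R_{m,i+1}], and summation by parts
   moves differences from [g] to the weight.  Part (a) is this summation by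
   parts; its boundary terms vanish because [R_{m,i} w_i] is eventually monotone,
   being the tail of a sum of terms of constant sign.
   For part (b), the factors [1 - j delta] are positive because [w_{i+1}] cannot
   be nonincreasing and then nondecreasing, a Hardy inequality takes
   [Delta^n g] in [L^2 (w_n)] down to [Delta^i g] in [L^2 (w_i)], and Parseval
   holds because polynomials are dense: if [delta <= 0] or the support is finite,
   [w_i] lives on a half-line and has a geometric tail.  On the half-line the
   functions [n |-> 'C(n, m) s^(n - m)] are polynomials for [s = 1]; expanding
   [(s - h)^(n - m)] shows that they stay in the closure of the polynomials as
   [s] decreases to [0] in finitely many steps, where they are the indicators of
   points. *)
Require Import Defs.
From HB Require Import structures.
From mathcomp Require Import all_boot all_order all_algebra.
From mathcomp Require Import all_classical all_reals all_analysis.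
From mathcomp Require Import measurable_realfun ring lra zify.

Set Implicit Arguments.
Unset Strict Implicit.
Unset Printing Implicit Defensive.

Import Order.TTheory GRing.Theory Num.Theory.
Import numFieldNormedType.Exports.

Local Open Scope classical_set_scope.
Local Open Scope ring_scope.

(** * Absolute summability and sums over the integers *)

Section bounded_sums.
Variable R : realType.
Implicit Types (u v : nat -> R) (f h : int -> R).

(** The analysis uses the unnormalized weights [wt i] and polynomials [rodpoly m i], whose
    identities hold at every integer, so that the ends of the support need no separate treatment;
    the square roots enter only when expectations are assembled. In part (a) the growth of [g] is
    not controlled: the only information is the absolute summability of the products with
    [Delta^i g], and the integrability of [phi_k g] is itself a conclusion. Each summation by parts
    must therefore deliver the summability that the next one starts from. In part (b) the formula
    for [i] is Parseval's identity for [Delta^i g] in [L^2 (w_i)], since the coefficient of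
    [Delta^i g] against [R_{m,i}] equals that of [g] against [R_{m+i,0}]. On a finite support the
    leading coefficient of [R_{m,i}] is known to be nonzero only for [m <= M - i], hence a reduction
    of degree before expanding. The descent of [s] needs small steps because the expansion of
    [(s - h)^(n - m)] is controlled by [(s + h)^(n - m)], which the weight tolerates only while
    [s + h] stays below its rate [rho], possibly barely above [1]. *)

Definition bsum u := exists B, forall L, \sum_(n < L) `|u n| <= B.

Lemma bsum_le u v : bsum v -> (forall n, `|u n| <= `|v n|) -> bsum u.
Proof.
move=> [B vB] uv; exists B => L; apply: le_trans (vB L).
by apply: ler_sum => n _; exact: uv.
Qed.

Lemma bsumD u v : bsum u -> bsum v -> bsum (fun n => u n + v n).
Proof.
move=> [B uB] [C vC]; exists (B + C) => L.
apply: le_trans (lerD (uB L) (vC L)); rewrite -big_split /=.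
by apply: ler_sum => n _; exact: ler_normD.
Qed.

Lemma bsumZ c u : bsum u -> bsum (fun n => c * u n).
Proof.
move=> [B uB]; exists (`|c| * B) => L.
under eq_bigr do rewrite normrM.
by rewrite -mulr_sumr ler_wpM2l.
Qed.

Lemma bsum_drop N u : bsum (fun n => u (N + n)%N) <-> bsum u.
Proof.
split=> [[B uB]|[B uB]].
  exists (\sum_(n < N) `|u n| + B) => L.
  apply: (@le_trans _ _ (\sum_(n < L + N) `|u n|)).
    by rewrite big_split_ord /= lerDl; exact: sumr_ge0.
  by rewrite addnC big_split_ord /= lerD2l; exact: uB.
exists B => L; apply: le_trans (uB (N + L)%N).
by rewrite big_split_ord /= lerDr; exact: sumr_ge0.
Qed.

Lemma bsum_cvg_norm u : bsum u -> cvgn (fun L => \sum_(n < L) `|u n|).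
Proof.
move=> [B uB]; apply: nondecreasing_is_cvgn; last by exists B => _ [L _ <-].
apply/nondecreasing_seqP => L.
by rewrite big_ord_recr /= lerDl.
Qed.

Lemma bsum_cvg u : bsum u -> cvgn (fun L => \sum_(n < L) u n).
Proof.
move=> /bsum_cvg_norm uc.
have -> : (fun L => \sum_(n < L) u n) = series u.
  by apply/funext => L; rewrite /series /= big_mkord.
apply: normed_cvg; rewrite (_ : [normed series u] = fun L => \sum_(n < L) `|u n|) //.
by apply/funext => L; exact: big_mkord.
Qed.

Lemma bsum_cvg0 u : bsum u -> u @ \oo --> (0 : R).
Proof.
move=> /bsum_cvg; have -> : (fun L => \sum_(n < L) u n) = series u.
  by apply/funext => L; rewrite /series /= big_mkord.
exact: cvg_series_cvg_0.
Qed.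

Lemma bsum_tail u e : bsum u -> 0 < e ->
  exists N, forall L, \sum_(n < L) `|u (N + n)%N| <= e.
Proof.
move=> ub e0; have /bsum_cvg_norm uc := ub.
have und : {homo (fun L => \sum_(n < L) `|u n|) : n m / (n <= m)%N >-> n <= m}.
  by apply/nondecreasing_seqP => L; rewrite big_ord_recr /= lerDl.
have := uc => /cvgrPdist_le /(_ e e0)[N _ HN].
exists N => L.
have := HN N (leqnn N); have := nondecreasing_cvgn_le und uc (N + L)%N.
rewrite big_split_ord /= => h1; rewrite ler_norml => /andP[_].
lra.
Qed.

Lemma bsum_eventually0 u N : (forall n, (N <= n)%N -> u n = 0) -> bsum u.
Proof.
move=> u0; apply/(bsum_drop N); exists 0 => L.
by rewrite big1 // => n _; rewrite u0 ?normr0 // leq_addr.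
Qed.

(* Absolute summability over the integers; the value at 0 enters twice. *)
Definition sbl f := bsum (fun n => f n%:Z) /\ bsum (fun n => f (- n%:Z)).

Lemma sbl_le f h : sbl h -> (forall j, `|f j| <= `|h j|) -> sbl f.
Proof. by move=> [h1 h2] fh; split; [apply: bsum_le h1 _|apply: bsum_le h2 _]. Qed.

Lemma sblD f h : sbl f -> sbl h -> sbl (fun j => f j + h j).
Proof. by move=> [f1 f2] [h1 h2]; split; exact: bsumD. Qed.

Lemma sblZ c f : sbl f -> sbl (fun j => c * f j).
Proof. by move=> [f1 f2]; split; exact: bsumZ. Qed.

Lemma sblN f : sbl f -> sbl (fun j => - f j).
Proof. by move=> fs; apply: sbl_le fs _ => j; rewrite normrN. Qed.

Lemma sbl0 : sbl (fun=> 0).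
Proof. by split; apply: (@bsum_eventually0 _ 0%N). Qed.

Lemma sbl_sum (I : Type) (s : seq I) (F : I -> int -> R) :
  (forall i, sbl (F i)) -> sbl (fun j => \sum_(i <- s) F i j).
Proof.
move=> Fs; elim: s => [|i s IH].
  by under eq_fun do rewrite big_nil; exact: sbl0.
by under eq_fun do rewrite big_cons; exact: sblD.
Qed.

Lemma sbl_halves (N : nat) f : bsum (fun n => f (N%:Z + n%:Z)) ->
  bsum (fun n => f (- N%:Z - n%:Z)) -> sbl f.
Proof.
move=> f1 f2; split; apply/(bsum_drop N).
  by apply: bsum_le f1 _ => n; rewrite PoszD.
by apply: bsum_le f2 _ => n; rewrite PoszD opprD.
Qed.

Lemma sbl_right (N : nat) f : sbl f -> bsum (fun n => f (N%:Z + n%:Z)).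
Proof.
by move=> [f1 _]; apply: bsum_le ((bsum_drop N _).2 f1) _ => n; rewrite PoszD.
Qed.

Lemma sbl_left (N : nat) f : sbl f -> bsum (fun n => f (- N%:Z - n%:Z)).
Proof.
move=> [_ f1]; apply: bsum_le ((bsum_drop N _).2 f1) _ => n.
by rewrite PoszD opprD.
Qed.

Lemma sbl_refl f : sbl f -> sbl (fun j => f (- j)).
Proof.
by move=> [f1 f2]; split => //; apply: bsum_le f1 _ => n; rewrite opprK.
Qed.

(** Pairing [n] with [- n.+1] meets every integer once, and the partial sums run over the intervals
    from [- N] to [N - 1], on which telescoping is possible. *)
Definition psum f N := \sum_(n < N) (f n%:Z + f (- n.+1%:Z)).

Lemma psumS f N : psum f N.+1 = psum f N + (f N%:Z + f (- N.+1%:Z)).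
Proof. by rewrite /psum big_ord_recr. Qed.

Definition tot f := limn (psum f).

Lemma psum_cvg f : sbl f -> psum f @ \oo --> tot f.
Proof.
move=> [f1 f2]; apply: (@bsum_cvg (fun n => f n%:Z + f (- n.+1%:Z))).
apply: (@bsumD (fun n => f n%:Z) (fun n => f (- n.+1%:Z))) => //.
exact: ((bsum_drop 1 (fun n => f (- n%:Z))).2 f2).
Qed.

Lemma totP f l : psum f @ \oo --> l -> tot f = l.
Proof. by apply: cvg_lim. Qed.

Lemma totD f h : sbl f -> sbl h -> tot (fun j => f j + h j) = tot f + tot h.
Proof.
move=> fs hs; apply: totP.
rewrite (_ : psum _ = psum f \+ psum h); first by apply: cvgD; exact: psum_cvg.
by apply/funext => N; rewrite /psum /= -big_split; apply: eq_bigr => n _; exact: addrACA.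
Qed.

Lemma totZ c f : sbl f -> tot (fun j => c * f j) = c * tot f.
Proof.
move=> fs; apply: totP.
rewrite (_ : psum _ = (fun N => c * psum f N)).
  by apply: cvgMr; exact: psum_cvg.
by apply/funext => N; rewrite /psum mulr_sumr; apply: eq_bigr => n _; rewrite mulrDr.
Qed.

Lemma totB f h : sbl f -> sbl h -> tot (fun j => f j - h j) = tot f - tot h.
Proof.
move=> fs hs; under eq_fun do rewrite -mulN1r.
by rewrite totD ?totZ ?mulN1r //; exact: sblZ.
Qed.

Lemma tot0 : tot (fun=> 0) = 0 :> R.
Proof.
apply: totP; rewrite (_ : psum _ = cst 0); first exact: cvg_cst.
by apply/funext => N; rewrite /psum big1 // => n _; rewrite addr0.
Qed.

Lemma psum_le_tot f N : sbl f -> (forall j, 0 <= f j) -> psum f N <= tot f.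
Proof.
move=> fs f0; apply: nondecreasing_cvgn_le; last exact: psum_cvg fs.
by apply/nondecreasing_seqP => L; rewrite /psum big_ord_recr /= lerDl addr_ge0.
Qed.

Lemma tot_ge0 f : sbl f -> (forall j, 0 <= f j) -> 0 <= tot f.
Proof. by move=> fs f0; have := psum_le_tot 0 fs f0; rewrite /psum big_ord0. Qed.

Lemma le_tot_term f j : sbl f -> (forall j, 0 <= f j) -> f j <= tot f.
Proof.
move=> fs f0; apply: le_trans (psum_le_tot `|j|.+1 fs f0).
rewrite /psum; case: j => n /=.
  rewrite big_ord_recr /=; have := f0 (- n.+1%:Z).
  suff : 0 <= \sum_(i < n) (f i%:Z + f (- i.+1%:Z)) by lra.
  by apply: sumr_ge0 => i _; rewrite addr_ge0.
rewrite NegzE big_ord_recr big_ord_recr /=.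
have := f0 n; have := f0 n.+1; have := f0 (- n.+2%:Z).
suff : 0 <= \sum_(i < n) (f i%:Z + f (- i.+1%:Z)) by lra.
by apply: sumr_ge0 => i _; rewrite addr_ge0.
Qed.

End bounded_sums.

(** * Summation by parts and a Hardy inequality *)

Section summation_by_parts.
Variable R : realType.
Implicit Types (F g V w : nat -> R).

Lemma cvg_addn F (l : R) n :
  F @ \oo --> l -> (fun r => F (n + r)%N) @ \oo --> l.
Proof.
move=> Fl; rewrite (_ : (fun r => _) = (fun r => F (r + n)%N)).
  by rewrite cvg_shiftn.
by apply/funext => r; rewrite addnC.
Qed.

Lemma abel_summation F (G : nat -> R) L :
  \sum_(n < L) (F n - F n.+1) * G n.+1 =
  F 0 * G 0 + \sum_(n < L) F n * (G n.+1 - G n) - F L * G L.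
Proof.
elim: L => [|L IH]; first by rewrite !big_ord0; ring.
by rewrite !big_ord_recr /= IH; ring.
Qed.

(* Dominating [g] by the nondecreasing [G := |g 0| + sum |g' |] turns the
   absolute summability of [F * g'] into that of [F' * G] by Abel summation. *)
Lemma half_line_parts_mono F g : F @ \oo --> (0 : R) ->
  (forall n, F n.+1 <= F n) -> bsum (fun n => F n * (g n.+1 - g n)) ->
  [/\ bsum (fun n => (F n - F n.+1) * g n.+1),
      (fun n => F n * g n.+1) @ \oo --> (0 : R)
    & (fun n => F n * g n) @ \oo --> (0 : R)].
Proof.
move=> Fc Fd Fg.
have Fni : nonincreasing_seq F by apply/nonincreasing_seqP.
have F0 n : 0 <= F n.
  by have := nonincreasing_cvgn_ge Fni (cvgP _ Fc) n; rewrite (cvg_lim _ Fc).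
pose G n : R := `|g 0| + \sum_(j < n) `|g j.+1 - g j|.
have GS n : G n.+1 = G n + `|g n.+1 - g n| by rewrite /G big_ord_recr addrA.
have gG n : `|g n| <= G n.
  elim: n => [|n IH]; first by rewrite /G big_ord0 addr0.
  rewrite GS -[in X in X <= _](subrK (g n) (g n.+1)).
  by apply: le_trans (ler_normD _ _) _; rewrite addrC lerD2r.
have G0 n : 0 <= G n by exact: le_trans (normr_ge0 _) (gG n).
have dF n : 0 <= F n - F n.+1 by rewrite subr_ge0.
pose S L : R := \sum_(n < L) (F n - F n.+1) * G n.+1.
have AG : bsum (fun n => (F n - F n.+1) * G n.+1).
  case: (Fg) => B FB; exists (F 0 * G 0 + B) => L.
  under eq_bigr do rewrite ger0_norm ?mulr_ge0 //.
  rewrite abel_summation -addrA lerD2l.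
  apply: le_trans (FB L); rewrite lerBlDr.
  apply: (@le_trans _ _ (\sum_(n < L) `|F n * (g n.+1 - g n)|)); last first.
    by rewrite lerDl mulr_ge0.
  by apply: ler_sum => n _; rewrite GS addrAC subrr add0r normrM ger0_norm.
have /cvg_ex[T ST] : cvgn S := bsum_cvg AG.
(* As [G] is nondecreasing, [(F n - F (n + r)) * G n] is at most the part of the Abel sum between
   [n] and [n + r]. Letting [r] grow bounds [F n * G n] by a tail of a convergent series, so the
   boundary term vanishes. *)
have FGS n : F n * G n <= T - S n.
  have h r : (F n - F (n + r)%N) * G n <= S (n + r)%N - S n.
    elim: r => [|r IH]; first by rewrite addn0 !subrr mul0r.
    rewrite addnS /S big_ord_recr /= -/(S (n + r)%N) -/(S n).
    have GnG : G n <= G (n + r).+1.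
      rewrite /G lerD2l -addnS big_split_ord /= lerDl; exact: sumr_ge0.
    have -> : (F n - F (n + r).+1) * G n =
        (F n - F (n + r)%N) * G n + (F (n + r)%N - F (n + r).+1) * G n by ring.
    by rewrite addrAC; apply: lerD => //; rewrite ler_wpM2l.
  have c1 : (fun r => (F n - F (n + r)%N) * G n) @ \oo --> (F n - 0) * G n.
    apply: cvgMl; apply: cvgB; first exact: cvg_cst.
    exact: cvg_addn.
  have c2 : (fun r => S (n + r)%N - S n) @ \oo --> T - S n.
    apply: cvgB; last exact: cvg_cst.
    exact: cvg_addn.
  have := ler_cvg_to c1 c2; rewrite subr0; apply.
  by near=> r; exact: h.
have TS0 : (fun n => T - S n) @ \oo --> (0 : R).
  by rewrite -(subrr T); apply: cvgB => //; exact: cvg_cst.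
have FG0 : (fun n => F n * G n) @ \oo --> (0 : R).
  apply: (squeeze_cvgr _ (cvg_cst 0) TS0).
  by near=> n; rewrite mulr_ge0 //= FGS.
have FG1 : (fun n => F n * G n.+1) @ \oo --> (0 : R).
  have -> : (fun n => F n * G n.+1) =
            (fun n => F n * G n + `|F n * (g n.+1 - g n)|).
    by apply/funext => n; rewrite GS mulrDr normrM (ger0_norm (F0 n)).
  rewrite -(addr0 0); apply: cvgD => //.
  by rewrite -(@normr0 _ R); apply: cvg_norm; exact: bsum_cvg0.
split.
- apply: bsum_le AG _ => n.
  by rewrite !normrM ler_wpM2l // (le_trans (gG _)) // ler_norm.
- apply/norm_cvg0P; apply: (squeeze_cvgr _ (cvg_cst 0) FG1).
  by near=> n; rewrite normr_ge0 /= normrM ger0_norm // ler_wpM2l.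
- apply/norm_cvg0P; apply: (squeeze_cvgr _ (cvg_cst 0) FG0).
  by near=> n; rewrite normr_ge0 /= normrM ger0_norm // ler_wpM2l.
Unshelve. all: by end_near.
Qed.

Lemma half_line_parts N F g : F @ \oo --> (0 : R) ->
  (forall n, (N <= n)%N -> 0 <= F n - F n.+1) \/
  (forall n, (N <= n)%N -> F n - F n.+1 <= 0) ->
  bsum (fun n => F n * (g n.+1 - g n)) ->
  [/\ bsum (fun n => (F n - F n.+1) * g n.+1),
      (fun n => F n * g n.+1) @ \oo --> (0 : R)
    & (fun n => F n * g n) @ \oo --> (0 : R)].
Proof.
wlog : F / forall n, (N <= n)%N -> 0 <= F n - F n.+1 => [pos Fc [Fs|Fs] Fg|Fs Fc _ Fg].
- by apply: pos => //; left.
- have nF n : (N <= n)%N -> 0 <= - F n - - F n.+1.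
    by move=> /Fs; lra.
  have [] := pos (fun n => - F n) nF.
  + by rewrite -oppr0; exact: cvgN.
  + by left.
  + by apply: bsum_le Fg _ => n; rewrite mulNr normrN.
  move=> h1 h2 h3; split.
  + by apply: bsum_le h1 _ => n; rewrite -opprB opprK mulNr normrN addrC.
  + rewrite -oppr0 (_ : (fun n => _) = \- (fun n => - F n * g n.+1)).
      exact: cvgN.
    by apply/funext => n /=; rewrite mulNr opprK.
  + rewrite -oppr0 (_ : (fun n => _) = \- (fun n => - F n * g n)).
      exact: cvgN.
    by apply/funext => n /=; rewrite mulNr opprK.
- have [] := @half_line_parts_mono (fun n => F (n + N)%N) (fun n => g (n + N)%N).
  + by rewrite cvg_shiftn.
  + by move=> n; rewrite -subr_ge0; apply: Fs; exact: leq_addl.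
  + by apply: bsum_le ((bsum_drop N _).2 Fg) _ => n; rewrite addSn [(n + N)%N]addnC.
  move=> h1 h2 h3; split.
  + apply/(bsum_drop N); apply: bsum_le h1 _ => n.
    by rewrite [(N + n)%N]addnC -addSn.
  + by rewrite -(cvg_shiftn N).
  + by rewrite -(cvg_shiftn N).
Qed.

Lemma sum_by_parts (F g : int -> R) (N : nat) :
  sbl F -> sbl (fun j => F j * fdiff g j) ->
  (forall j, N%:Z <= j -> 0 <= F (j - 1) - F j) \/
  (forall j, N%:Z <= j -> F (j - 1) - F j <= 0) ->
  (forall j, j <= - N%:Z -> 0 <= F (j - 1) - F j) \/
  (forall j, j <= - N%:Z -> F (j - 1) - F j <= 0) ->
  sbl (fun j => (F (j - 1) - F j) * g j) /\
  tot (fun j => (F (j - 1) - F j) * g j) = tot (fun j => F j * fdiff g j).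
Proof.
move=> Fs FDs Fr Fl.
have [r1 r2 _] : [/\ bsum (fun n : nat => (F n%:Z - F n.+1%:Z) * g n.+1%:Z),
    (fun n : nat => F n%:Z * g n.+1%:Z) @ \oo --> (0 : R)
  & (fun n : nat => F n%:Z * g n%:Z) @ \oo --> (0 : R)].
  apply: (@half_line_parts N (fun n => F n%:Z) (fun n => g n%:Z)).
  - exact: bsum_cvg0 Fs.1.
  - have e n : n%:Z = n.+1%:Z - 1 by lia.
    by case: Fr => Fr; [left|right] => n Nn; rewrite e; apply: Fr; lia.
  - apply: bsum_le FDs.1 _ => n; rewrite /fdiff.
    by rewrite (_ : n%:Z + 1 = n.+1%:Z) //; lia.
have e n : - n.+1%:Z - 1 = - n.+2%:Z :> int by lia.
have [l1 _ l3] : [/\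
    bsum (fun n : nat => (F (- n.+1%:Z) - F (- n.+2%:Z)) * g (- n.+1%:Z)),
    (fun n : nat => F (- n.+1%:Z) * g (- n.+1%:Z)) @ \oo --> (0 : R)
  & (fun n : nat => F (- n.+1%:Z) * g (- n%:Z)) @ \oo --> (0 : R)].
  (* On the left, [F (- n.+1)] goes with [g (- n)]: [F j] multiplies a forward difference of [g],
     which reaches one point further to the right. *)
  apply: (@half_line_parts N (fun n => F (- n.+1%:Z)) (fun n => g (- n%:Z))).
  - exact: bsum_cvg0 ((bsum_drop 1 (fun n => F (- n%:Z))).2 Fs.2).
  - case: Fl => Fl; [right|left] => n Nn.
      have /Fl : - n.+1%:Z <= - N%:Z by lia.
      by rewrite e; lra.
    have /Fl : - n.+1%:Z <= - N%:Z by lia.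
    by rewrite e; lra.
  - pose v (n : nat) := F (- n%:Z) * fdiff g (- n%:Z).
    apply: bsum_le ((bsum_drop 1 v).2 FDs.2) _ => n; rewrite /v.
    rewrite /fdiff (_ : - (1 + n)%N%:Z + 1 = - n%:Z) ?add1n; last by lia.
    by rewrite -opprB mulrN normrN.
have As : sbl (fun j => (F (j - 1) - F j) * g j).
  split; apply/(bsum_drop 1).
    apply: bsum_le r1 _ => n; rewrite add1n (_ : n.+1%:Z - 1 = n%:Z) //; lia.
  by apply: bsum_le l1 _ => n; rewrite add1n e -opprB mulNr normrN.
split=> //; apply: totP.
(* What telescoping leaves at the two ends of the interval from [- N] to [N - 1]. *)
pose b (N : nat) : R := F (- N.+1%:Z) * g (- N%:Z) - F (N%:Z - 1) * g N%:Z.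
have -> : psum (fun j => (F (j - 1) - F j) * g j) =
    (fun N => psum (fun j => F j * fdiff g j) N + b N).
  apply/funext; elim=> [|M IH].
    rewrite /psum !big_ord0 /b (_ : 0%:Z - 1 = - 1%:Z) // (_ : - 0%:Z = 0%:Z) //.
    by rewrite subrr addr0.
  rewrite !psumS IH /b /fdiff.
  have -> : - M.+1%:Z + 1 = - M%:Z :> int by lia.
  have -> : M%:Z + 1 = M.+1%:Z :> int by lia.
  have -> : M.+1%:Z - 1 = M%:Z :> int by lia.
  rewrite e; ring.
rewrite -[X in _ --> X]addr0; apply: cvgD; first exact: psum_cvg.
rewrite -(subr0 0); apply: cvgB => //.
rewrite -(cvg_shiftS (fun n : nat => F (n%:Z - 1) * g n%:Z)).
have -> // : (fun n : nat => F (n.+1%:Z - 1) * g n.+1%:Z) =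
    (fun n : nat => F n%:Z * g n.+1%:Z).
by apply/funext => n; rewrite (_ : n.+1%:Z - 1 = n%:Z) //; lia.
Qed.

(** Cauchy-Schwarz against the constant sequence [1]. *)
Lemma sqr_sum_le (a : nat -> R) n :
  (\sum_(j < n) a j) ^+ 2 <= n%:R * \sum_(j < n) a j ^+ 2.
Proof.
elim: n => [|n IH]; first by rewrite !big_ord0 expr0n mul0r.
rewrite !big_ord_recr /=; move: IH.
set s := \sum_(_ < _) _; set q := \sum_(_ < _) _ => IH.
rewrite -natr1 mulrDl mul1r mulrDr.
have n0 : 0 <= n%:R :> R by [].
suff : 2 * s * a n <= q + n%:R * a n ^+ 2 by rewrite sqrrD; lra.
have [n_0|npos] := eqVneq n%:R (0 : R).
  move: IH; rewrite n_0 mul0r => s0.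
  have /eqP -> : s == 0 by rewrite -sqrf_eq0 eq_le s0 sqr_ge0.
  by rewrite mulr0 !mul0r addr0; apply: sumr_ge0 => i _; exact: sqr_ge0.
have np : 0 < n%:R :> R by rewrite lt_def npos n0.
rewrite -(ler_pM2l np); apply: (@le_trans _ _ (s ^+ 2 + (n%:R * a n) ^+ 2)).
  have := sqr_ge0 (s - n%:R * a n); lra.
by rewrite mulrDr exprMn [n%:R ^+ 2]expr2 -[n%:R * n%:R * _]mulrA lerD2r.
Qed.

(* Weighted Hardy inequality: by the third hypothesis [V] dominates the tail sums
   of [n * w n]. *)
Lemma half_line_hardy V w g : (forall n, 0 <= w n) -> (forall n, 0 <= V n) ->
  (forall n, n.+1%:R * w n.+1 <= V n - V n.+1) -> bsum w ->
  bsum (fun n => V n * (g n.+1 - g n) ^+ 2) -> bsum (fun n => w n * g n ^+ 2).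
Proof.
move=> w0 V0 wV ws [B VB].
(* Cauchy-Schwarz bounds [(g n - g 0) ^+ 2] by [n * D n]. The factor [n] is absorbed by the
   hypothesis on [V n - V n.+1], and Abel summation then puts [V n] against the increments of
   [D]. *)
pose D n : R := \sum_(j < n) (g j.+1 - g j) ^+ 2.
have D0 n : 0 <= D n by apply: sumr_ge0 => i _; exact: sqr_ge0.
have gD n : (g n - g 0) ^+ 2 <= n%:R * D n.
  apply: le_trans (sqr_sum_le (fun j => g j.+1 - g j) n).
  rewrite le_eqVlt; apply/orP; left; apply/eqP.
  congr (_ ^+ 2); elim: n => [|n IH]; first by rewrite big_ord0 subrr.
  by rewrite big_ord_recr /= -IH; ring.
have h : bsum (fun n => w n.+1 * (g n.+1 - g 0) ^+ 2).
  exists B => L; apply: le_trans (VB L).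
  apply: (@le_trans _ _ (\sum_(n < L) (V n - V n.+1) * D n.+1)).
    apply: ler_sum => n _; rewrite ger0_norm; last first.
      by apply: mulr_ge0 => //; exact: sqr_ge0.
    apply: le_trans (ler_wpM2r (D0 _) (wV n)).
    by rewrite [n.+1%:R * w _]mulrC -mulrA ler_wpM2l.
  rewrite (abel_summation V D) {1}/D big_ord0 mulr0 add0r lerBlDr.
  apply: (@le_trans _ _ (\sum_(n < L) `|V n * (g n.+1 - g n) ^+ 2|)).
    apply: ler_sum => n _; rewrite ger0_norm; last first.
      by apply: mulr_ge0 => //; exact: sqr_ge0.
    by rewrite ler_wpM2l // /D big_ord_recr /= addrAC subrr add0r.
  by rewrite lerDl mulr_ge0.
have {}h := (bsum_drop 1 (fun n => w n * (g n - g 0) ^+ 2)).1 h.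
apply: bsum_le (bsumD (bsumZ 2 h) (bsumZ (2 * g 0 ^+ 2) ws)) _ => n.
rewrite ger0_norm; last by apply: mulr_ge0 => //; exact: sqr_ge0.
apply: le_trans (ler_norm _).
apply: (@le_trans _ _ (w n * (2 * (g n - g 0) ^+ 2 + 2 * g 0 ^+ 2))); last lra.
rewrite ler_wpM2l //.
have := sqr_ge0 (g n - 2 * g 0); lra.
Qed.

End summation_by_parts.

(** * Leading coefficients and eventual signs of polynomials *)

Section leading_terms.
Variable R : realType.
Implicit Types (u v : {poly R}) (a b c : R).

(** Only an upper bound on the degree: [a] may be [0], so possibly vanishing factors [1 - j delta]
    need no case distinction. *)
Definition lead_at m a u := (size u <= m.+1)%N /\ u`_m = a.

Lemma lead_at_add m a b u v :
  lead_at m a u -> lead_at m b v -> lead_at m (a + b) (u + v).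
Proof.
move=> [u1 <-] [v1 <-]; split; last by rewrite coefD.
by rewrite (leq_trans (size_polyD _ _)) // geq_max u1.
Qed.

Lemma lead_at_scale m a c u : lead_at m a u -> lead_at m (c * a) (c *: u).
Proof.
move=> [u1 <-]; split; last by rewrite coefZ.
exact: leq_trans (size_scale_leq _ _) u1.
Qed.

Lemma lead_at_mulX m a u : lead_at m a u -> lead_at m.+1 a (u * 'X).
Proof.
move=> [u1 <-]; split; last by rewrite coefMX.
by rewrite (leq_trans (size_polyMleq _ _)) // size_polyX addn2.
Qed.

Lemma lead_at_small m u : (size u <= m)%N -> lead_at m 0 u.
Proof. by move=> um; split; [exact: leqW|rewrite nth_default]. Qed.

Lemma lead_at_eq m a b u : lead_at m a u -> a = b -> lead_at m b u.
Proof. by move=> + <-. Qed.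

Definition pshift c u := u \Po ('X + c%:P).

Lemma pshiftE c u x : (pshift c u).[x] = u.[x + c].
Proof. by rewrite horner_comp !hornerE. Qed.

(** The factor ['X] makes up for the degree lost by differencing, which avoids the predecessor of
    [m] and covers constants. *)
Lemma lead_at_diff_mulX c u m : (size u <= m.+1)%N ->
  lead_at m (c * m%:R * u`_m) ((pshift c u - u) * 'X).
Proof.
elim/poly_ind: u m => [|u b IH] m.
  rewrite /pshift comp_poly0 subr0 mul0r coef0 mulr0 => _.
  by split; rewrite ?size_poly0 ?coef0.
rewrite size_MXaddC; case: ifPn => [/andP[/eqP -> /eqP ->] _|_].
  rewrite mul0r addr0 /pshift comp_poly0 subr0 mul0r coef0 mulr0.
  by split; rewrite ?size_poly0 ?coef0.
case: m => [|m]; rewrite !ltnS => um.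
  move: um; rewrite leqn0 size_poly_eq0 => /eqP ->.
  rewrite mul0r add0r /pshift comp_polyC subrr mul0r mulr0 mul0r.
  by split; rewrite ?size_poly0 ?coef0.
have h1 := IH m um.
have h2 : lead_at m u`_m (pshift c u).
  have [s1 _] := h1; have d1 : (size (pshift c u - u)%R <= m)%N.
    have [->|d0] := eqVneq (pshift c u - u) 0; first by rewrite size_poly0.
    by move: s1; rewrite size_mulX.
  rewrite -[pshift c u](subrK u) -[u`_m]add0r; apply: lead_at_add => //.
  exact: lead_at_small.
rewrite coefD coefMX coefC /= addr0.
have -> : (pshift c (u * 'X + b%:P) - (u * 'X + b%:P)) * 'X =
    ((pshift c u - u) * 'X) * 'X + c *: (pshift c u * 'X).
  rewrite /pshift comp_poly_MXaddC -mul_polyC; ring.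
apply: lead_at_eq (lead_at_add (lead_at_mulX h1)
  (lead_at_scale c (lead_at_mulX h2))) _.
by rewrite -natr1; ring.
Qed.

Lemma size_pshift_sub c u m : (size u <= m.+1)%N -> (size (pshift c u - u)%R <= m)%N.
Proof.
move=> /(lead_at_diff_mulX c)[+ _].
have [->|d0] := eqVneq (pshift c u - u) 0; first by rewrite size_poly0.
by rewrite size_mulX.
Qed.

Lemma coef_pshift_sub c u m : (size u <= m.+2)%N ->
  (pshift c u - u)`_m = c * m.+1%:R * u`_m.+1.
Proof. by move=> /(lead_at_diff_mulX c)[_]; rewrite coefMX. Qed.

Lemma lead_at_pshift m a c u : lead_at m a u -> lead_at m a (pshift c u).
Proof.
move=> [u1 <-]; rewrite -[pshift c u](subrK u) -[u`_m]add0r.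
by apply: lead_at_add => //; apply: lead_at_small; exact: size_pshift_sub.
Qed.

(* By induction on the degree: the difference has eventually a constant sign,
   so the polynomial is eventually monotone. *)
Lemma poly_eventually_sign u : exists N : nat,
  (forall n, (N <= n)%N -> 0 <= u.[n%:R]) \/
  (forall n, (N <= n)%N -> u.[n%:R] <= 0).
Proof.
have [m um] := ubnP (size u); elim: m => // m IH in u um *.
case: m => [|m] in IH um.
  exists 0%N; left => n _; move: um; rewrite ltnS leqn0 size_poly_eq0 => /eqP ->.
  by rewrite horner0.
have [N HN] := IH _ (size_pshift_sub 1 um : (_ < m.+1)%N).
have step n : (pshift 1 u - u).[n%:R] = u.[n.+1%:R] - u.[n%:R].
  by rewrite hornerD hornerN pshiftE natr1.
case: HN => HN.
  have [[n Nn un]|h] := pselect (exists2 n, (N <= n)%N & 0 < u.[n%:R]).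
    exists n; left => r nr; rewrite -(subnK nr) addnC.
    elim: (r - n)%N => [|s IHs]; first by rewrite addn0 ltW.
    by have := HN _ (leq_trans Nn (leq_addr s n)); rewrite step addnS; lra.
  exists N; right => n Nn; rewrite leNgt; apply/negP => un; apply: h.
  by exists n.
have [[n Nn un]|h] := pselect (exists2 n, (N <= n)%N & u.[n%:R] < 0).
  exists n; right => r nr; rewrite -(subnK nr) addnC.
  elim: (r - n)%N => [|s IHs]; first by rewrite addn0 ltW.
  by have := HN _ (leq_trans Nn (leq_addr s n)); rewrite step addnS; lra.
exists N; left => n Nn; rewrite leNgt; apply/negP => un; apply: h.
by exists n.
Qed.

Lemma poly_sign_right u : exists N : nat,
  (forall j : int, N%:Z <= j -> 0 <= u.[j%:~R]) \/
  (forall j : int, N%:Z <= j -> u.[j%:~R] <= 0).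
Proof.
have [N HN] := poly_eventually_sign u; exists N.
by case: HN => HN; [left|right] => -[n|n] Nn //; exact: HN.
Qed.

Lemma poly_sign_left u : exists N : nat,
  (forall j : int, j <= - N%:Z -> 0 <= u.[j%:~R]) \/
  (forall j : int, j <= - N%:Z -> u.[j%:~R] <= 0).
Proof.
have [N HN] := poly_sign_right (u \Po (- 'X)); exists N.
have e j : (u \Po - 'X).[(- j)%:~R] = u.[j%:~R].
  by rewrite horner_comp !hornerE mulrNz opprK.
by case: HN => HN; [left|right] => j jN; rewrite -e; apply: HN; lia.
Qed.

End leading_terms.

(** * The weights [w_i] and the Rodrigues polynomials [R_{m,i}] *)

Section weights.
Variable R : realType.
Variables (delta beta gamma mu : R).
Implicit Types (u v : {poly R}).

Definition qpoly : {poly R} := delta *: 'X^2 + beta *: 'X + gamma%:P.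

Lemma qpolyE j : quad delta beta gamma j = qpoly.[j%:~R].
Proof. by rewrite /quad /qpoly !hornerE. Qed.

(** Subtracting the defining relations of the family at [j] and [j + 1] gives [q(j) p(j) = (q(j + 1)
    + (j + 1) - mu) p(j + 1)]; this is the polynomial on the right. *)
Definition rpoly : {poly R} := qpoly + 'X - mu%:P.

Definition rodop (i : nat) u := pshift (- 1) u * rpoly - u * pshift i%:R qpoly.

Lemma rodopE i u x :
  (rodop i u).[x] = u.[x - 1] * rpoly.[x] - u.[x] * qpoly.[x + i%:R].
Proof.
rewrite /rodop hornerD hornerN; congr (_ - _); first by rewrite hornerM pshiftE.
by rewrite hornerM pshiftE.
Qed.

Fixpoint rodpoly (m i : nat) : {poly R} :=
  if m is m'.+1 then rodop i (rodpoly m' i.+1) else 1.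

(** The two products in [rodop] share the leading term [delta * a] in degree [m + 2], which cancels.
    In degree [m + 1], [- m delta] comes from shifting [u], [1] from the extra ['X] in [rpoly] and
    [- 2 i delta] from shifting [q]. *)
Lemma lead_at_rodop m a i u : lead_at m a u ->
  lead_at m.+1 (a * (1 - (m + 2 * i)%:R * delta)) (rodop i u).
Proof.
move=> ua; have ua1 := lead_at_pshift (- 1) ua.
have d := lead_at_diff_mulX (- 1) ua.1.
have -> : rodop i u = delta *: (((pshift (- 1) u - u) * 'X) * 'X) +
    (beta + 1) *: (pshift (- 1) u * 'X) +
    - (beta + 2 * i%:R * delta) *: (u * 'X) +
    ((gamma - mu) *: pshift (- 1) u + - qpoly.[i%:R] *: u).
  rewrite /rodop /rpoly.
  have -> : pshift i%:R qpoly = delta *: 'X^2 + (beta + 2 * i%:R * delta) *: 'X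
      + (qpoly.[i%:R])%:P.
    rewrite /pshift /qpoly !comp_polyD !comp_polyZ comp_polyC comp_polyX.
    rewrite comp_Xn_poly !hornerE -!mul_polyC !polyCD !polyCM !polyCD; ring.
  rewrite /qpoly -!mul_polyC !polyCD !polyCN !polyCD ?polyCN !polyCM; ring.
have small : lead_at m.+1 0
    ((gamma - mu) *: pshift (- 1) u + - qpoly.[i%:R] *: u).
  apply: lead_at_small; rewrite (leq_trans (size_polyD _ _)) // geq_max.
  by rewrite !(leq_trans (size_scale_leq _ _)) ?ua.1 ?ua1.1.
apply: lead_at_eq (lead_at_add (lead_at_add (lead_at_add
  (lead_at_scale _ (lead_at_mulX d)) (lead_at_scale _ (lead_at_mulX ua1)))
  (lead_at_scale _ (lead_at_mulX ua))) small) _.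
by rewrite ua.2 natrD natrM; ring.
Qed.

Lemma lead_at_rodpoly m i :
  lead_at m (Pi_ delta m (m.-1 + 2 * i)) (rodpoly m i).
Proof.
elim: m i => [|m IH] i.
  by rewrite /Pi_ big_geq //; split; rewrite ?size_poly1 ?coef1.
apply: lead_at_eq (lead_at_rodop i (IH i.+1)) _.
rewrite /Pi_ [RHS]big_ltn /=; last by rewrite addSn ltnS leq_addl.
rewrite mulrC; congr (_ * _).
case: m {IH} => [|m]; first by rewrite !big_geq.
by rewrite /=; apply: congr_big_nat => //; lia.
Qed.

Lemma size_rodpoly m i : (size (rodpoly m i) <= m.+1)%N.
Proof. exact: (lead_at_rodpoly m i).1. Qed.

Variable p : int -> R.
Hypothesis p_rec : forall j,
  qpoly.[j%:~R] * p j = rpoly.[(j + 1)%:~R] * p (j + 1).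

Definition wt i (j : int) : R := rising i (quad delta beta gamma) j * p j.

Lemma wt_eq0 i j : p j = 0 -> wt i j = 0.
Proof. by rewrite /wt => ->; rewrite mulr0. Qed.

Lemma wt0 j : wt 0 j = p j.
Proof. by rewrite /wt /rising big_ord0 mul1r. Qed.

Lemma wtS i j : wt i.+1 j = qpoly.[(j + i%:Z)%:~R] * wt i j.
Proof. by rewrite /wt /rising big_ord_recr /= qpolyE; ring. Qed.

(** The recurrence of [p] passes to all levels. Together with [wtS] it writes both [wt i.+1 (j - 1)]
    and [wt i.+1 j] as polynomial multiples of [wt i j]. *)
Lemma wtS_right i j : wt i.+1 j = rpoly.[(j + 1)%:~R] * wt i (j + 1).
Proof.
elim: i => [|i IH]; first by rewrite wtS !wt0 addr0 p_rec.
rewrite wtS IH wtS mulrCA; congr (_ * (_.[_%:~R] * _)); lia.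
Qed.

Lemma rodop_wt i u j :
  u.[(j - 1)%:~R] * wt i.+1 (j - 1) - u.[j%:~R] * wt i.+1 j =
  (rodop i u).[j%:~R] * wt i j.
Proof.
rewrite rodopE wtS_right wtS subrK !intrD mulrNz.
ring.
Qed.

(** This is [rodop_wt] for [u = 1]. The factor is only linear in [j]; if its slope is nonzero, its
    root is the mean [mu_i] of [X_i]. *)
Lemma wt_diff i j : wt i.+1 (j - 1) - wt i.+1 j =
  ((1 - 2 * i%:R * delta) * j%:~R - (mu + delta * i%:R ^+ 2 + beta * i%:R)) *
  wt i j.
Proof.
have := rodop_wt i 1 j; rewrite !hornerC !mul1r => ->; congr (_ * _).
rewrite rodopE !hornerC /rpoly /qpoly !hornerE /=; ring.
Qed.

(** The free shift [s] carries the induction: raising the level [i] by one while [n] drops by one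
    moves the argument of the weight by one. *)
Lemma rodrigues_wt n i s j :
  fdiffn n (fun l => wt (i + n) (l - n%:Z - s%:Z)) j =
  (-1) ^+ n * ((rodpoly n i).[(j - s%:Z)%:~R] * wt i (j - s%:Z)).
Proof.
elim: n i s j => [|n IH] i s j.
  by rewrite /= expr0 mul1r hornerC mul1r addn0 subr0.
have -> : (fun l => wt (i + n.+1) (l - n.+1%:Z - s%:Z)) =
    (fun l => wt (i.+1 + n) (l - n%:Z - s.+1%:Z)).
  by apply/funext => l; congr wt; lia.
rewrite /fdiffn iterS -/(fdiffn n _) /fdiff !IH -mulrBr.
have -> : j + 1 - s.+1%:Z = j - s%:Z by lia.
have -> : j - s.+1%:Z = j - s%:Z - 1 by lia.
by rewrite -opprB rodop_wt exprS mulN1r mulrN mulNr.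
Qed.

End weights.

(** * Signs of monotone summable functions; moments *)

Section integer_tails.
Variable R : realType.
Implicit Types (F : int -> R).

Lemma int_nonincreasing F (a j l : int) :
  (forall x, a < x -> F x <= F (x - 1)) -> a <= j -> j <= l -> F l <= F j.
Proof.
move=> Fd aj jl; have [n ->] : exists n : nat, l = j + n%:Z.
  by exists `|l - j|%N; lia.
elim: n => [|n IH]; first by rewrite addr0.
apply: le_trans IH; have -> : j + n%:Z = j + n.+1%:Z - 1 by lia.
by apply: Fd; lia.
Qed.

Lemma sbl_tail_right F (a j : int) : sbl F ->
  (forall x, a < x -> F x <= F (x - 1)) -> a <= j -> 0 <= F j.
Proof.
move=> Fs Fd aj; rewrite leNgt; apply/negP => Fj.
have e0 : 0 < - F j by rewrite oppr_gt0.
have := bsum_cvg0 Fs.1 => /cvgrPdist_lt /(_ _ e0)[N _ HN].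
have /= := HN (maxn N `|j|) (leq_maxl _ _); rewrite sub0r normrN.
have := int_nonincreasing Fd aj (_ : j <= (maxn N `|j|)%:Z).
move=> /(_ ltac:(lia)) h; rewrite ltNge => /negP; apply.
by apply: le_trans (_ : - F (maxn N `|j|)%:Z <= _); rewrite ?lerN2 // -normrN ler_norm.
Qed.

Lemma sbl_tail_left F (a j : int) : sbl F ->
  (forall x, x <= a -> F (x - 1) <= F x) -> j <= a -> 0 <= F j.
Proof.
move=> Fs Fd ja; rewrite -[j]opprK.
apply: (@sbl_tail_right (fun x => F (- x)) (- a) (- j)); [exact: sbl_refl| |lia].
move=> x ax; have -> : - x = - (x - 1) - 1 by lia.
by apply: Fd; lia.
Qed.

End integer_tails.

Section moments.
Variable R : realType.
Implicit Types (p : int -> R) (u : {poly R}).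

Definition mom K p := sbl p /\ sbl (fun j => `|j%:~R| ^+ K * p j).

Lemma exprn_le1D (x : R) i K : 0 <= x -> (i <= K)%N -> x ^+ i <= 1 + x ^+ K.
Proof.
move=> x0 iK; have [x1|x1] := leP x 1.
  by rewrite (le_trans (exprn_ile1 _ x0 x1)) // lerDl exprn_ge0.
by rewrite (le_trans (ler_weXn2l (ltW x1) iK)) // lerDr.
Qed.

Lemma mom_sbl K p u : mom K p -> (size u <= K.+1)%N ->
  sbl (fun j => u.[j%:~R] * p j).
Proof.
move=> [p0 pK] uK.
have -> : (fun j => u.[j%:~R] * p j) =
    (fun j => \sum_(i <- index_enum 'I_K.+1) u`_i * (j%:~R ^+ i * p j)).
  apply/funext => j; rewrite (horner_coef_wide _ uK) mulr_suml.
  by apply: eq_bigr => i _; rewrite mulrA.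
apply: sbl_sum => i; apply: sblZ; apply: sbl_le (sblD p0 pK) _ => j.
rewrite -[X in `|X + _|]mul1r -mulrDl !normrM ler_wpM2r // normrX.
rewrite [X in _ <= X]ger0_norm ?addr_ge0 ?exprn_ge0 //.
by apply: exprn_le1D => //; rewrite -ltnS.
Qed.

End moments.

(** * Positivity of the weights, and the half-line results applied to them *)

Section weight_positivity.
Variable R : realType.
Variables (delta beta gamma mu : R) (p : int -> R) (K : nat).
Hypothesis p_rec : forall j, (qpoly delta beta gamma).[j%:~R] * p j =
  (rpoly delta beta gamma mu).[(j + 1)%:~R] * p (j + 1).
Hypothesis p_ge0 : forall j, 0 <= p j.
Hypothesis p_mom : mom K p.
Hypothesis K_ge2 : (2 <= K)%N.
Implicit Types (u : {poly R}) (g h : int -> R).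
Local Notation wt := (wt delta beta gamma p).
Local Notation rodop := (rodop delta beta gamma mu).
Local Notation rodpoly := (rodpoly delta beta gamma mu).

(** [wt i] is [p] times a polynomial of degree at most [2 i], so the size condition keeps the total
    degree within the [K] available moments. *)
Lemma sbl_wt u i : (size u + 2 * i <= K.+1)%N -> sbl (fun j => u.[j%:~R] * wt i j).
Proof.
move=> ui.
have [v [sv vE]] : exists v : {poly R}, (size v <= 2 * i + 1)%N /\
    forall j : int, wt i j = v.[j%:~R] * p j.
  elim: i {ui} => [|i [v [sv vE]]].
    by exists 1; rewrite size_poly1; split=> // j; rewrite wt0 hornerC mul1r.
  exists (pshift i%:R (qpoly delta beta gamma) * v); split.
    rewrite (leq_trans (size_polyMleq _ _)) //.
    have : (size (pshift i%:R (qpoly delta beta gamma)) <= 3)%N.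
      apply: (lead_at_pshift (a := delta) _ _).1; split.
        rewrite /qpoly (leq_trans (size_polyD _ _)) // geq_max.
        rewrite (leq_trans (size_polyD _ _)) ?(leq_trans (size_polyC_leq1 _)) //.
        by rewrite geq_max !(leq_trans (size_scale_leq _ _)) ?size_polyXn ?size_polyX.
      by rewrite /qpoly !coefD !coefZ coefXn coefX coefC /=; ring.
    lia.
  by move=> j; rewrite wtS vE hornerM pshiftE intrD mulrA.
have -> : (fun j => u.[j%:~R] * wt i j) = (fun j => (u * v).[j%:~R] * p j).
  by apply/funext => j; rewrite vE hornerM mulrA.
apply: mom_sbl p_mom _; rewrite (leq_trans (size_polyMleq _ _)) //; lia.
Qed.

Lemma sbl_wt1 i : (2 * i <= K)%N -> sbl (wt i).
Proof.
move=> iK; apply: sbl_le (@sbl_wt 1 i _) _; first by rewrite size_poly1 add1n.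
by move=> j; rewrite hornerC mul1r.
Qed.

Lemma wt1_diff j : wt 1 (j - 1) - wt 1 j = (j%:~R - mu) * p j.
Proof. by rewrite (wt_diff p_rec) wt0; congr (_ * _); ring. Qed.

Let s1 : sbl (wt 1). Proof. exact: sbl_wt1. Qed.

Let dec_right j l : mu <= j%:~R -> j <= l -> wt 1 l <= wt 1 j.
Proof.
move=> mj; apply: int_nonincreasing (lexx j) => x jx.
rewrite -subr_ge0 wt1_diff mulr_ge0 // subr_ge0 (le_trans mj) // ler_int ltW //.
Qed.

Let inc_left j l : j%:~R <= mu -> l <= j -> wt 1 l <= wt 1 j.
Proof.
move=> jm lj.
have := @int_nonincreasing _ (fun x => wt 1 (- x)) (- j) (- j) (- l) _ (lexx _).
rewrite !opprK; apply; last by lia.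
move=> x jx; have -> : - x = - (x - 1) - 1 by lia.
rewrite -subr_le0 wt1_diff mulr_le0_ge0 // subr_le0 (le_trans _ jm) // ler_int.
lia.
Qed.

(** [wt 1] increases up to the mean [mu], decreases afterwards, and is summable, hence tends to [0]
    at both ends. *)
Lemma wt1_ge0 j : 0 <= wt 1 j.
Proof.
have [mj|/ltW jm] := leP mu j%:~R.
  apply: (@sbl_tail_right _ _ j) => // x jx.
  rewrite -subr_ge0 wt1_diff mulr_ge0 // subr_ge0 (le_trans mj) // ler_int ltW //.
apply: (@sbl_tail_left _ _ j) => // x jx.
by rewrite -subr_le0 wt1_diff mulr_le0_ge0 // subr_le0 (le_trans _ jm) // ler_int.
Qed.

Lemma wt1_gt0 l j r : l <= j -> j < r -> 0 < p l -> 0 < p r -> 0 < wt 1 j.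
Proof.
move=> lj jr pl pr; have [mj|jm] := leP mu j%:~R.
  apply: (@lt_le_trans _ _ (wt 1 (r - 1))); last by apply: dec_right => //; lia.
  have := wt1_diff r; have := wt1_ge0 r.
  have : 0 < (r%:~R - mu) * p r.
    by rewrite mulr_gt0 // subr_gt0 (le_lt_trans mj) // ltr_int.
  lra.
apply: (@lt_le_trans _ _ (wt 1 l)); last by apply: inc_left => //; exact: ltW.
have := wt1_diff l; have := wt1_ge0 (l - 1).
have : 0 < (mu - l%:~R) * p l.
  by rewrite mulr_gt0 // subr_gt0 (le_lt_trans _ jm) // ler_int.
lra.
Qed.

(** [wt 1 j = q j * p j] is positive from [l] to [r - 1], so [p] cannot vanish there. *)
Lemma supp_interval l j r : l <= j -> j <= r -> 0 < p l -> 0 < p r -> 0 < p j.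
Proof.
rewrite [j <= r]le_eqVlt => lj /orP[/eqP -> //|jr] pl pr.
have := wt1_gt0 lj jr pl pr; rewrite wtS wt0 lt_def mulf_eq0 negb_or.
by move=> /andP[/andP[_ p0] _]; rewrite lt_def p0 p_ge0.
Qed.

(** The two claims need a joint induction: where [wt i j] is positive, [j + i] is a point of the
    support, and there [0 <= wt 1 (j + i)] gives the sign of the next factor [q (j + i)]. *)
Lemma wt_ge0_gt0P i j : 0 <= wt i j /\ (0 < wt i j) = (0 < p j) && (0 < p (j + i%:Z)).
Proof.
elim: i => [|i [IH0 IH1]]; first by rewrite wt0 addr0 andbb.
have e : j + i.+1%:Z = j + i%:Z + 1 by lia.
rewrite e wtS; have [wi|wi] := eqVneq (wt i j) 0.
  rewrite wi mulr0; split=> //; rewrite ltxx; apply/esym/negbTE/negP.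
  move=> /andP[pj pe]; move: IH1; rewrite wi ltxx pj /=.
  by rewrite (supp_interval _ _ pj pe) //; lia.
have wi0 : 0 < wt i j by rewrite lt_def wi.
move: (wi0); rewrite IH1 => /andP[pj pji].
have := wt1_ge0 (j + i%:Z); rewrite wtS wt0 addr0 pmulr_lge0 // => q0.
split; first by rewrite mulr_ge0.
rewrite pmulr_lgt0 // pj /=; apply/idP/idP => [q1|p1].
  have : 0 < wt 1 (j + i%:Z) by rewrite wtS wt0 addr0 mulr_gt0.
  rewrite (wtS_right p_rec) wt0 lt_def mulf_eq0 negb_or => /andP[/andP[_ h] _].
  by rewrite lt_def h p_ge0.
have := wt1_gt0 (lexx _) (_ : j + i%:Z < j + i%:Z + 1) pji p1.
by rewrite wtS wt0 addr0 pmulr_lgt0 //; apply; lia.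
Qed.

Lemma wt_ge0 i j : 0 <= wt i j.
Proof. exact: (wt_ge0_gt0P i j).1. Qed.

Lemma wt_gt0P i j : (0 < wt i j) = (0 < p j) && (0 < p (j + i%:Z)).
Proof. exact: (wt_ge0_gt0P i j).2. Qed.

(* Otherwise [wt i.+1] would be a nonnegative summable function that is
   nonincreasing up to some point and nondecreasing afterwards. *)
Lemma slope_gt0 i j : (2 * i.+1 <= K)%N -> 0 < wt i.+1 j -> 0 < 1 - 2 * i%:R * delta.
Proof.
move=> iK wj; rewrite ltNge; apply/negP => l0.
have ws : sbl (fun j => - wt i.+1 j) by apply: sblN; exact: sbl_wt1.
set c := mu + delta * i%:R ^+ 2 + beta * i%:R.
have [h|h] := leP 0 ((1 - 2 * i%:R * delta) * j%:~R - c).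
  have : 0 <= - wt i.+1 j.
    apply: (@sbl_tail_left _ (fun j => - wt i.+1 j) j j ws _ (lexx _)) => x xj.
    rewrite lerN2 -subr_ge0 (wt_diff p_rec) mulr_ge0 ?wt_ge0 //.
    apply: le_trans h _; rewrite lerD2r ler_wnM2l // ler_int //.
  by rewrite oppr_ge0 leNgt wj.
have : 0 <= - wt i.+1 j.
  apply: (@sbl_tail_right _ (fun j => - wt i.+1 j) j j ws _ (lexx _)) => x xj.
  rewrite lerN2 -subr_le0 (wt_diff p_rec) mulr_le0_ge0 ?wt_ge0 //.
  apply: le_trans (ltW h); rewrite lerD2r ler_wnM2l // ler_int ltW //.
by rewrite oppr_ge0 leNgt wj.
Qed.

Lemma slope_factor_gt0 i j n : (2 * i.+1 <= K)%N -> 0 < wt i.+1 j ->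
  (n <= 2 * i)%N -> 0 < 1 - n%:R * delta.
Proof.
move=> iK wj ni; have := slope_gt0 iK wj.
have [d0|d0] := leP delta 0.
  by move=> _; rewrite subr_gt0 (le_lt_trans _ ltr01) // mulr_ge0_le0.
move=> h; apply: lt_le_trans h _; rewrite lerD2l lerN2 ler_wpM2r ?(ltW d0) //.
by rewrite -natrM ler_nat.
Qed.

Lemma Pi_gt0 i j n m : (2 * i.+1 <= K)%N -> 0 < wt i.+1 j ->
  (n + m <= (2 * i).+1)%N -> 0 < Pi_ delta n m.
Proof.
move=> iK wj nm; rewrite /Pi_ big_nat; apply: prodr_gt0 => l /andP[_ ln].
by apply: (slope_factor_gt0 iK wj); lia.
Qed.

Lemma wt_parts u i g : (size u + 2 * i.+1 <= K.+1)%N ->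
  sbl (fun j => u.[j%:~R] * wt i.+1 j * fdiff g j) ->
  sbl (fun j => (rodop i u).[j%:~R] * wt i j * g j) /\
  tot (fun j => (rodop i u).[j%:~R] * wt i j * g j) =
  tot (fun j => u.[j%:~R] * wt i.+1 j * fdiff g j).
Proof.
move=> uK us; have Fs := sbl_wt uK.
have [N1 H1] := poly_sign_right (rodop i u).
have [N2 H2] := poly_sign_left (rodop i u).
have E j := rodop_wt p_rec i u j.
have := @sum_by_parts _ (fun j => u.[j%:~R] * wt i.+1 j) g (maxn N1 N2) Fs us.
have AE : (fun j => (u.[(j - 1)%:~R] * wt i.+1 (j - 1) - u.[j%:~R] * wt i.+1 j) * g j)
    = (fun j => (rodop i u).[j%:~R] * wt i j * g j).
  by apply/funext => j; rewrite E.
rewrite /= AE; apply.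
- case: H1 => H1; [left|right] => j jN; rewrite E.
    by rewrite mulr_ge0 ?wt_ge0 //; apply: H1; lia.
  by rewrite mulr_le0_ge0 ?wt_ge0 //; apply: H1; lia.
- case: H2 => H2; [left|right] => j jN; rewrite E.
    by rewrite mulr_ge0 ?wt_ge0 //; apply: H2; lia.
  by rewrite mulr_le0_ge0 ?wt_ge0 //; apply: H2; lia.
Qed.

(** Each summation by parts raises the degree of the polynomial by one and lowers that of the weight
    by two, so the moment condition at the top level suffices for all [n] steps. *)
Lemma rodpoly_parts m n i g : (m + 2 * (i + n) <= K)%N ->
  sbl (fun j => (rodpoly m (i + n)).[j%:~R] * wt (i + n) j * fdiffn n g j) ->
  sbl (fun j => (rodpoly (m + n) i).[j%:~R] * wt i j * g j) /\
  tot (fun j => (rodpoly (m + n) i).[j%:~R] * wt i j * g j) =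
  tot (fun j => (rodpoly m (i + n)).[j%:~R] * wt (i + n) j * fdiffn n g j).
Proof.
elim: n m => [|n IH] m mK; first by rewrite !addn0.
rewrite addnS => h.
have [h1 h2] := @wt_parts (rodpoly m (i + n).+1) (i + n) (fdiffn n g)
  (leq_trans (leq_add (size_rodpoly _ _ _ _ m _) (leqnn _))
     (ltac:(lia) : (m.+1 + 2 * (i + n).+1 <= K.+1)%N)) h.
have [h3 h4] := IH m.+1 ltac:(lia) h1.
by rewrite addnS -addSn; split=> //; rewrite h4 -h2.
Qed.

(** Divided by the slope [l], [wt_diff] says that [wt i.+1 / l] has the differences
    [(j - c) * wt i j]; this is the [V] of the Hardy inequality. *)
Lemma wt_hardy i h : (2 * i.+1 <= K)%N -> 0 < 1 - 2 * i%:R * delta ->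
  sbl (fun j => wt i.+1 j * fdiff h j ^+ 2) -> sbl (fun j => wt i j * h j ^+ 2).
Proof.
move=> iK; set l := 1 - _ => l0 hs.
pose c := (mu + delta * i%:R ^+ 2 + beta * i%:R) / l.
have E j : wt i.+1 (j - 1) / l - wt i.+1 j / l = (j%:~R - c) * wt i j.
  rewrite -mulrBl (wt_diff p_rec) -/l /c; field; exact: lt0r_neq0.
(* Since [N] exceeds [|c|], a point at distance [n] beyond [N] or [- N] has [|j - c| >= n], the
   factor required of [V]. *)
pose N := (Num.truncn `|c|).+1.
have cN : `|c| <= N%:R.
  by rewrite ltW // truncnS_gt.
have wis : sbl (wt i) by apply: sbl_wt1; lia.
have {}hs : sbl (fun j => l^-1 * (wt i.+1 j * fdiff h j ^+ 2)) by exact: sblZ.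
apply: (@sbl_halves _ N).
- apply: (@half_line_hardy _ (fun n => wt i.+1 (N%:Z + n%:Z) / l)
    (fun n => wt i (N%:Z + n%:Z)) (fun n => h (N%:Z + n%:Z))).
  + by move=> n; exact: wt_ge0.
  + by move=> n; rewrite divr_ge0 ?wt_ge0 // ltW.
  + move=> n; have -> : N%:Z + n%:Z = N%:Z + n.+1%:Z - 1 by lia.
    rewrite E; apply: ler_wpM2r; first exact: wt_ge0.
    rewrite intrD.
    have := ler_norm c; have : N%:~R = N%:R :> R by [].
    have : n.+1%:~R = n.+1%:R :> R by [].
    lra.
  + exact: sbl_right.
  + apply: bsum_le (sbl_right N hs) _ => n.
    have -> : N%:Z + n.+1%:Z = N%:Z + n%:Z + 1 by lia.
    by rewrite -/(fdiff h _) [X in _ <= `|X|]mulrA [l^-1 * _]mulrC.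
- apply: (@half_line_hardy _ (fun n => wt i.+1 (- N%:Z - n.+1%:Z) / l)
    (fun n => wt i (- N%:Z - n%:Z)) (fun n => h (- N%:Z - n%:Z))).
  + by move=> n; exact: wt_ge0.
  + by move=> n; rewrite divr_ge0 ?wt_ge0 // ltW.
  + move=> n; have -> : - N%:Z - n.+2%:Z = - N%:Z - n.+1%:Z - 1 by lia.
    rewrite -[X in _ <= X]opprB E -mulNr; apply: ler_wpM2r; first exact: wt_ge0.
    rewrite intrD !mulrNz.
    have := ler_norm (- c); rewrite normrN; have : N%:~R = N%:R :> R by [].
    have : n.+1%:~R = n.+1%:R :> R by [].
    lra.
  + exact: sbl_left.
  + apply: bsum_le ((bsum_drop 1 _).2 (sbl_left N hs)) _ => n.
    rewrite add1n /fdiff; have -> : - N%:Z - n.+1%:Z + 1 = - N%:Z - n%:Z by lia.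
    by rewrite -sqrrN opprB [X in _ <= `|X|]mulrA [l^-1 * _]mulrC.
Qed.

End weight_positivity.

(** * Density of polynomials for a geometrically decaying weight on a half-line *)

Section polynomial_density.
Variable R : realType.
Variables (v : nat -> R) (rho : R).
Hypothesis v_ge0 : forall n, 0 <= v n.
Hypothesis rho_gt1 : 1 < rho.
Hypothesis v_exp : bsum (fun n => v n * (rho ^+ n) ^+ 2).
Implicit Types (f : nat -> R) (u : {poly R}).

(** Bounding all partial sums by [e] makes the error finite without a separate summability claim. *)
Definition approx f := forall e, 0 < e -> exists u : {poly R}, forall L,
  \sum_(n < L) v n * (f n - u.[n%:R]) ^+ 2 <= e.

Lemma sum_tail_le (a b : nat -> R) N L : (forall n, 0 <= a n) ->
  (forall n, (n < N)%N -> a n = 0) -> (forall n, (N <= n)%N -> a n <= b n) ->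
  \sum_(n < L) a n <= \sum_(n < L) b (N + n)%N.
Proof.
move=> a0 aN ab; apply: (@le_trans _ _ (\sum_(n < N + L) a n)).
  by rewrite addnC big_split_ord /= lerDl; exact: sumr_ge0.
rewrite big_split_ord /= big1 ?add0r; last by move=> n _; exact: aN.
by apply: ler_sum => n _; apply: ab; exact: leq_addr.
Qed.

Lemma sqrD_le (x y : R) : (x + y) ^+ 2 <= 2 * x ^+ 2 + 2 * y ^+ 2.
Proof. by have := sqr_ge0 (x - y); lra. Qed.

Lemma approx_closed f : (forall e, 0 < e -> exists2 f', approx f' &
    forall L, \sum_(n < L) v n * (f n - f' n) ^+ 2 <= e) -> approx f.
Proof.
move=> H e e0; have e4 : 0 < e / 4 by rewrite divr_gt0.
have [f' f'a fe] := H _ e4; have [u ue] := f'a _ e4.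
exists u => L.
apply: (@le_trans _ _ (2 * \sum_(n < L) v n * (f n - f' n) ^+ 2 +
    2 * \sum_(n < L) v n * (f' n - u.[n%:R]) ^+ 2)).
  rewrite !mulr_sumr -big_split /=; apply: ler_sum => n _.
  rewrite ![2 * (v n * _)]mulrCA -mulrDr ler_wpM2l //.
  by apply: le_trans (sqrD_le _ _); rewrite addrA subrK.
have := fe L; have := ue L; lra.
Qed.

Lemma approx_poly u : approx (fun n => u.[n%:R]).
Proof.
move=> e e0; exists u => L; rewrite big1 ?(ltW e0) // => n _.
by rewrite subrr expr0n mulr0.
Qed.

Lemma approxD f g : approx f -> approx g -> approx (fun n => f n + g n).
Proof.
move=> fa ga e e0; have e4 : 0 < e / 4 by rewrite divr_gt0.
have [u ue] := fa _ e4; have [w we] := ga _ e4.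
exists (u + w) => L.
apply: (@le_trans _ _ (2 * \sum_(n < L) v n * (f n - u.[n%:R]) ^+ 2 +
    2 * \sum_(n < L) v n * (g n - w.[n%:R]) ^+ 2)).
  rewrite !mulr_sumr -big_split /=; apply: ler_sum => n _.
  rewrite ![2 * (v n * _)]mulrCA -mulrDr ler_wpM2l //.
  by apply: le_trans (sqrD_le _ _); rewrite hornerD opprD addrACA.
have := ue L; have := we L; lra.
Qed.

Lemma approxZ c f : approx f -> approx (fun n => c * f n).
Proof.
move=> fa e e0; have c1 : 0 < c ^+ 2 + 1 by rewrite ltr_wpDl ?sqr_ge0.
have [u ue] := fa _ (divr_gt0 e0 c1); exists (c *: u) => L.
have -> : \sum_(n < L) v n * (c * f n - (c *: u).[n%:R]) ^+ 2 =
    c ^+ 2 * \sum_(n < L) v n * (f n - u.[n%:R]) ^+ 2.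
  by rewrite mulr_sumr; apply: eq_bigr => n _; rewrite hornerZ; ring.
apply: le_trans (ler_wpM2l (sqr_ge0 c) (ue L)) _.
by rewrite mulrA ler_pdivrMr // [X in _ <= X]mulrC ler_wpM2r ?(ltW e0) // lerDl.
Qed.

Lemma approx_sum (I : Type) (s : seq I) (F : I -> nat -> R) :
  (forall i, approx (F i)) -> approx (fun n => \sum_(i <- s) F i n).
Proof.
move=> Fa; elim: s => [|i s IH].
  under eq_fun do rewrite big_nil.
  by have := approx_poly 0; under eq_fun do rewrite horner0.
under eq_fun do rewrite big_cons.
exact: (@approxD (F i) (fun n => \sum_(i <- s) F i n)).
Qed.

(** Up to the factor [m!] this is the [m]-th derivative of [s ^+ n] in [s], so a Taylor expansion in
    [s] stays within the family. The truncated [n - m] is harmless: the binomial coefficient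
    vanishes for [n < m]. *)
Definition binexp (s : R) m n := 'C(n, m)%:R * s ^+ (n - m).

Lemma approx_binexp1 m : approx (binexp 1 m).
Proof.
suff [u uE] : exists u : {poly R}, forall n, u.[n%:R] = 'C(n, m)%:R.
  have := approx_poly u; congr approx; apply/funext => n.
  by rewrite uE /binexp expr1n mulr1.
elim: m => [|m [u uE]]; first by exists 1 => n; rewrite hornerC bin0.
exists (m.+1%:R^-1 *: (u * ('X - m%:R%:P))) => n.
rewrite hornerZ hornerM uE hornerXsubC; apply: (@mulfI _ m.+1%:R) => //.
rewrite mulrA divff ?pnatr_eq0 // mul1r -natrM mul_bin_left.
have [mn|nm] := leqP m n; first by rewrite natrM natrB // mulrC.
by rewrite bin_small // muln0 mul0r.
Qed.

Lemma bin_trinomial n m l : (m <= n)%N ->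
  ('C(m + l, l) * 'C(n, m + l) = 'C(n, m) * 'C(n - m, l))%N.
Proof.
move=> mn; have [mln|nml] := leqP (m + l) n; last first.
  by rewrite (@bin_small n) // (@bin_small (n - m)) ?muln0 // ltn_subLR.
have lnm : (l <= n - m)%N by rewrite leq_subRL.
have e1 := bin_fact mln; have e2 := bin_fact mn; have e3 := bin_fact lnm.
have := bin_fact (leq_addl m l); rewrite addnK => e4.
have g0 : (0 < l`! * m`! * (n - m - l)`!)%N by rewrite !muln_gt0 !fact_gt0.
apply/eqP; rewrite -(eqn_pmul2r g0); apply/eqP.
transitivity n`!.
  rewrite -e1 -e4 subnDA; ring.
rewrite -e2 -e3; ring.
Qed.

Lemma exprDn_wide (x y : R) N L : (N < L)%N ->
  (x + y) ^+ N = \sum_(l < L) 'C(N, l)%:R * x ^+ (N - l) * y ^+ l.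
Proof.
move=> /subnKC <-; rewrite big_split_ord /= [X in _ = _ + X]big1 ?addr0.
  by rewrite exprDn; apply: eq_bigr => l _; rewrite -mulr_natl mulrA.
by move=> l _; rewrite bin_small ?mul0r // ltnS leq_addr.
Qed.

(** [binexp s m n * (rho - s) ^+ m] is one of the nonnegative terms in the binomial expansion of
    [(s + (rho - s)) ^+ n]. *)
Lemma binexp_le s m n : 0 <= s -> s < rho ->
  binexp s m n <= rho ^+ n / (rho - s) ^+ m.
Proof.
move=> s0 sr; have r0 : 0 < rho - s by rewrite subr_gt0.
rewrite ler_pdivlMr ?exprn_gt0 // /binexp.
have [mn|nm] := leqP m n; last first.
  by rewrite bin_small // !mul0r exprn_ge0 // (le_trans s0) // ltW.
have e : rho = s + (rho - s) by ring.
rewrite [X in _ <= X ^+ n]e (exprDn_wide _ _ (ltnSn n)).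
rewrite (bigD1 (Ordinal (mn : (m < n.+1)%N))) //= lerDl; apply: sumr_ge0 => l _.
by rewrite !mulr_ge0 ?exprn_ge0 // ltW.
Qed.

(* Expanding [(s - h) ^ (n - m)] by the binomial theorem; the truncations are
   dominated by the same expansion of [(s + h) ^ (n - m)]. *)
Lemma approx_binexp_step s h : 0 <= h -> h <= s -> s + h < rho ->
  (forall m, approx (binexp s m)) -> forall m, approx (binexp (s - h) m).
Proof.
move=> h0 hs shr Ks m.
have s0 : 0 <= s := le_trans h0 hs.
pose T L n : R := \sum_(l < L) (- h) ^+ l * 'C(m + l, l)%:R * binexp s (m + l) n.
have TE L n : (m <= n)%N -> T L n =
    'C(n, m)%:R * \sum_(l < L) 'C(n - m, l)%:R * s ^+ (n - m - l) * (- h) ^+ l.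
  move=> mn; rewrite mulr_sumr; apply: eq_bigr => l _.
  have e : 'C(m + l, l)%:R * 'C(n, m + l)%:R = 'C(n, m)%:R * 'C(n - m, l)%:R :> R.
    by rewrite -!natrM bin_trinomial.
  transitivity ('C(m + l, l)%:R * 'C(n, m + l)%:R * s ^+ (n - m - l) * (- h) ^+ l).
    by rewrite /binexp subnDA; ring.
  by rewrite e; ring.
have T0 L n : (n < m)%N -> T L n = 0.
  move=> nm; apply: big1 => l _.
  rewrite /binexp (@bin_small n) ?mul0r ?mulr0 //; lia.
have b0 n : (n < m)%N -> binexp (s - h) m n = 0.
  by move=> nm; rewrite /binexp bin_small ?mul0r.
have Tle L n : `|T L n| <= binexp (s + h) m n.
  have [mn|nm] := leqP m n; last first.
    by rewrite T0 // normr0 mulr_ge0 ?exprn_ge0 ?addr_ge0.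
  rewrite TE // normrM ger0_norm // ler_wpM2l //.
  rewrite (@exprDn_wide _ _ _ ((n - m).+1 + L)) ?leq_addr //.
  apply: le_trans (ler_norm_sum _ _ _) _.
  rewrite addnC big_split_ord /= -[X in X <= _]addr0 lerD //.
    apply: ler_sum => l _; rewrite !normrM !normrX normrN.
    by rewrite (ger0_norm s0) (ger0_norm h0) ger0_norm.
  by apply: sumr_ge0 => l _; rewrite !mulr_ge0 ?exprn_ge0.
have Teq L n : (n < m + L)%N -> T L n = binexp (s - h) m n.
  have [mn nL|nm _] := leqP m n; last by rewrite T0 // b0.
  rewrite TE // /binexp (@exprDn_wide s (- h) _ L) // ltn_subLR //.
have ble n : `|binexp (s - h) m n| <= binexp (s + h) m n.
  by rewrite -(Teq n.+1) ?Tle // addnS ltnS leq_addl.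
apply: approx_closed => e e0.
(* The truncation [T N] is exact for [n < N]. Beyond, it and the target are both at most
   [rho ^+ n / (rho - (s + h)) ^+ m]; the square of twice this bound gives the [4]. *)
set C := 4 / ((rho - (s + h)) ^+ m) ^+ 2.
have r0 : 0 < rho - (s + h) by rewrite subr_gt0.
have C0 : 0 < C by rewrite divr_gt0 // !exprn_gt0.
have [N HN] := bsum_tail v_exp (divr_gt0 e0 C0).
exists (T N).
  by apply: approx_sum => l; apply: approxZ; exact: Ks.
move=> L; have := HN L; rewrite -(ler_pM2l C0) [C * (e / C)]mulrC divfK ?lt0r_neq0 //.
apply: le_trans; rewrite mulr_sumr.
apply: (@sum_tail_le (fun n => v n * (binexp (s - h) m n - T N n) ^+ 2)
  (fun n => C * `|v n * (rho ^+ n) ^+ 2|)) => [n|n nN|n nN].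
- by rewrite mulr_ge0 // sqr_ge0.
- by rewrite Teq ?subrr ?expr0n ?mulr0 // (leq_trans nN) // leq_addl.
rewrite ger0_norm; last by rewrite mulr_ge0 // sqr_ge0.
rewrite [X in _ <= X]mulrCA ler_wpM2l // /C mulrAC -mulrA -expr_div_n.
have -> : 4 = 2 ^+ 2 :> R by ring.
rewrite -exprMn -real_normK ?num_real // lerXn2r ?nnegrE ?normr_ge0 //.
  by rewrite mulr_ge0 // divr_ge0 ?exprn_ge0 // ltW // (lt_trans ltr01).
apply: le_trans (ler_normB _ _) _.
rewrite mulr_natl mulr2n; apply: lerD.
  by apply: le_trans (ble n) _; apply: binexp_le => //; exact: addr_ge0.
by apply: le_trans (Tle N n) _; apply: binexp_le => //; exact: addr_ge0.
Qed.

Lemma approx_binexp0 m : approx (binexp 0 m).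
Proof.
have r1 : 0 < rho - 1 by rewrite subr_gt0.
(* With steps [h = 1 / K < rho - 1], the condition [s + h < rho] holds all the way down from
   [s = 1]. *)
pose K := (Num.truncn (rho - 1)^-1).+1.
have K0 : 0 < K%:R :> R by [].
have Kr : K%:R^-1 < rho - 1.
  by rewrite -[rho - 1]invrK ltf_pV2 ?posrE ?invr_gt0 // truncnS_gt.
suff h t : (t <= K)%N -> forall m, approx (binexp (1 - t%:R / K%:R) m).
  by have := h K (leqnn _) m; rewrite divff ?lt0r_neq0 // subrr.
elim: t => [|t IH] tK {}m; first by rewrite mul0r subr0; exact: approx_binexp1.
have -> : 1 - t.+1%:R / K%:R = 1 - t%:R / K%:R - K%:R^-1 :> R.
  by rewrite -natr1; field; exact: lt0r_neq0.
apply: approx_binexp_step; [by rewrite invr_ge0| | |by apply: IH; exact: ltnW].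
  rewrite lerBrDr -[X in X + _]mul1r -mulrDl addrC natr1 ler_pdivrMr // mul1r.
  by rewrite ler_nat.
have : 0 <= t%:R / K%:R :> R by rewrite divr_ge0.
move: Kr; lra.
Qed.

Theorem polynomials_dense f : bsum (fun n => v n * f n ^+ 2) -> approx f.
Proof.
move=> fs; apply: approx_closed => e e0; have [N HN] := bsum_tail fs e0.
(* As [0 ^+ 0 = 1], [binexp 0 m] is the indicator of [m]: this is [f] cut off at [N]. *)
exists (fun n => \sum_(m < N) f m * binexp 0 m n).
  by apply: approx_sum => m; apply: approxZ; exact: approx_binexp0.
have E n : \sum_(m < N) f m * binexp 0 m n = if (n < N)%N then f n else 0.
  have b m : binexp 0 m n = (m == n)%:R.
    rewrite /binexp; have [->|mn] := eqVneq m n; first by rewrite binn subnn mulr1.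
    have [nm|mn'] := ltnP n m; first by rewrite bin_small // mul0r.
    by rewrite expr0n subn_eq0 leqNgt ltn_neqAle mn mn' mulr0.
  case: ifP => nN.
    rewrite (bigD1 (Ordinal nN)) //= b eqxx mulr1 big1 ?addr0 // => m.
    by rewrite b -val_eqE /= => /negbTE ->; rewrite mulr0.
  apply: big1 => m _; rewrite b; have [mn|] := eqVneq (m : nat) n.
    by move: nN; rewrite -mn ltn_ord.
  by rewrite mulr0.
move=> L; apply: le_trans (HN L).
apply: (@sum_tail_le (fun n => v n *
  (f n - \sum_(m < N) f m * binexp 0 m n) ^+ 2)
  (fun n => `|v n * f n ^+ 2|)) => [n|n nN|n nN].
- by rewrite mulr_ge0 // sqr_ge0.
- by rewrite E nN subrr expr0n mulr0.
- by rewrite E ltnNge nN subr0 ler_norm.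
Qed.

End polynomial_density.

(** * Weights on a half-line with a geometric tail *)

Section exponential_tails.
Variable R : realType.
Implicit Types (f h w : int -> R) (v : nat -> R).

Lemma psum_interval f M :
  psum f M = \sum_(n < M + M) f (n%:Z - M%:Z).
Proof.
elim: M => [|M IH]; first by rewrite /psum !big_ord0.
rewrite psumS IH addSn addnS big_ord_recr big_ord_recl /=.
have -> : (M + M).+1%:Z - M.+1%:Z = M%:Z by lia.
rewrite -addrA [RHS]addrC -addrA sub0r; congr (_ + _); apply: eq_bigr => n _.
by congr f; rewrite /bump /=; lia.
Qed.

Lemma tot_right f (N : nat) e : (forall j, 0 <= f j) ->
  (forall j, j < - N%:Z -> f j = 0) ->
  (forall L, \sum_(n < L) f (n%:Z - N%:Z) <= e) -> sbl f /\ tot f <= e.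
Proof.
move=> f0 fN fe.
have fs : sbl f.
  split; last by apply: (@bsum_eventually0 _ _ N.+1) => n Nn; apply: fN; lia.
  apply: bsum_le ((bsum_drop N (fun n => f (n%:Z - N%:Z))).2 _) _.
    by exists e => L; under eq_bigr do rewrite ger0_norm //.
  by move=> n; rewrite (_ : (N + n)%N%:Z - N%:Z = n%:Z) //; lia.
split=> //; apply: (cvgr_to_le (psum_cvg fs)); near=> M.
have NM : (N <= M)%N by near: M; exact: nbhs_infty_ge.
have -> : psum f M = \sum_(n < M + N) f (n%:Z - N%:Z); last exact: fe.
rewrite -(subnK NM); elim: (M - N)%N => [|r IH]; first exact: psum_interval.
rewrite addSn psumS IH addSn big_ord_recr /=; congr (_ + _).
by rewrite [X in _ + X]fN ?addr0; [congr f|]; lia.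
Unshelve. all: by end_near.
Qed.

Lemma tot_refl f : sbl f -> tot (fun j => f (- j)) = tot f.
Proof.
move=> fs; apply: totP.
have -> : psum (fun j => f (- j)) =
    (fun M : nat => psum f M + (f M%:Z - f (- M%:Z))).
  apply/funext; elim=> [|M IH]; first by rewrite /psum !big_ord0 oppr0 subrr addr0.
  by rewrite !psumS IH opprK; ring.
rewrite -[X in _ --> X]addr0; apply: cvgD; first exact: psum_cvg.
by rewrite -(subrr 0); apply: cvgB; apply: bsum_cvg0; [exact: fs.1|exact: fs.2].
Qed.

Lemma bsum_geometric (s : R) : 0 <= s -> s < 1 -> bsum (fun n => s ^+ n).
Proof.
move=> s0 s1; have d0 : 0 < 1 - s by rewrite subr_gt0.
exists (1 - s)^-1 => L; under eq_bigr do rewrite ger0_norm ?exprn_ge0 //.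
rewrite -(ler_pM2l d0) divff ?lt0r_neq0 //.
have -> : (1 - s) * \sum_(n < L) s ^+ n = 1 - s ^+ L.
  elim: L => [|L IH]; first by rewrite big_ord0 expr0 subrr mulr0.
  by rewrite big_ord_recr /= mulrDr IH exprS; ring.
by rewrite lerBlDr lerDl exprn_ge0.
Qed.

Lemma bsum_ratio v (r : R) n0 : (forall n, 0 <= v n) -> 0 <= r -> r < 1 ->
  (forall n, (n0 <= n)%N -> v n.+1 <= r * v n) ->
  exists2 rho, 1 < rho & bsum (fun n => v n * (rho ^+ n) ^+ 2).
Proof.
(* This [eps] gives [rho ^+ 2 <= 1 + 3 * eps], hence [rho ^+ 2 * r <= r + 3 * eps = 1 - eps], a
   ratio below [1]. *)
move=> v0 r0 r1 vr; pose eps := (1 - r) / 4; pose rho := 1 + eps.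
have eps0 : 0 < eps by rewrite divr_gt0 // subr_gt0.
have e4 : 4 * eps = 1 - r by rewrite /eps mulrC divfK.
exists rho; first by rewrite ltrDl.
have s1 : rho ^+ 2 * r < 1.
  have h : rho ^+ 2 <= 1 + 3 * eps.
    have : eps * eps <= 1 * eps by rewrite ler_wpM2r ?(ltW eps0) //; lra.
    by rewrite /rho; lra.
  apply: le_lt_trans (ler_wpM2r r0 h) _.
  have : eps * r <= eps * 1 by rewrite ler_wpM2l ?(ltW eps0) // ltW.
  by lra.
have s0 : 0 <= rho ^+ 2 * r by rewrite mulr_ge0 // sqr_ge0.
apply/(bsum_drop n0).
apply: bsum_le (bsumZ (v n0 * (rho ^+ n0) ^+ 2) (bsum_geometric s0 s1)) _ => n.
have pos m : 0 <= (rho ^+ m) ^+ 2 by exact: sqr_ge0.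
rewrite ger0_norm; last exact: mulr_ge0.
rewrite ger0_norm; last by apply: mulr_ge0; [exact: mulr_ge0|exact: exprn_ge0].
elim: n => [|n IH]; first by rewrite addn0 expr0 mulr1.
rewrite addnS [rho ^+ (n0 + n).+1]exprS [(_ * r) ^+ n.+1]exprS.
move: IH; set a := rho ^+ (n0 + n); set b := _ ^+ n => IH.
apply: (@le_trans _ _ (rho ^+ 2 * r * (v (n0 + n)%N * a ^+ 2))).
  have -> : rho ^+ 2 * r * (v (n0 + n)%N * a ^+ 2) = (rho * a) ^+ 2 * (r * v (n0 + n)%N).
    by ring.
  by rewrite [X in X <= _]mulrC ler_wpM2l ?sqr_ge0 // vr // leq_addr.
by rewrite [X in _ <= X]mulrCA ler_wpM2l.
Qed.

(** With [rho = s * s], one factor [s ^+ n] absorbs [n] and the other absorbs [n ^+ K]; the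
    induction therefore runs over all [rho]. *)
Lemma expn_le_geometric (rho : R) K : 1 < rho ->
  exists2 C, 0 <= C & forall n : nat, n%:R ^+ K <= C * rho ^+ n.
Proof.
elim: K rho => [|K IH] rho r1.
  by exists 1 => // n; rewrite expr0 mul1r exprn_ege1 // ltW.
have r0 : 0 <= rho by rewrite ltW // (lt_trans ltr01).
pose s := Num.sqrt rho.
have s1 : 1 < s by rewrite -sqrtr1 ltr_sqrt // (lt_trans ltr01).
have ss : s * s = rho by rewrite -expr2 sqr_sqrtr.
have [C C0 HC] := IH s s1.
have d0 : 0 < s - 1 by rewrite subr_gt0.
have b n : n%:R <= (s - 1)^-1 * s ^+ n.
  rewrite -(ler_pM2l d0) mulVKf ?lt0r_neq0 //.
  elim: n => [|n IHn]; first by rewrite mulr0 expr0.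
  rewrite -natr1 mulrDr mulr1 exprS.
  have s1n : 1 <= s ^+ n by rewrite exprn_ege1 // ltW.
  have : (s - 1) * 1 <= (s - 1) * s ^+ n by rewrite ler_wpM2l // ltW.
  by lra.
exists ((s - 1)^-1 * C) => [|n]; first by rewrite mulr_ge0 // invr_ge0 ltW.
rewrite exprS -ss exprMn mulrACA; apply: ler_pM => //; exact: exprn_ge0.
Qed.

(** The half-line from [- N] on is enumerated as [n - N], and [rho ^+ n] is squared as in the
    density theorem. Finite supports qualify too. *)
Definition exp_right w := exists (N : nat) (rho : R),
  [/\ 1 < rho, forall j : int, j < - N%:Z -> w j = 0
    & bsum (fun n => w (n%:Z - N%:Z) * (rho ^+ n) ^+ 2)].

Definition exp_tails w := exp_right w \/ exp_right (fun j => w (- j)).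

Lemma exp_right_mom w K : (forall j, 0 <= w j) -> exp_right w -> mom K w.
Proof.
move=> w0 [N [rho [r1 wN ws]]].
suff h k : sbl (fun j => `|j%:~R| ^+ k * w j).
  by split=> //; have := h 0%N; under eq_fun do rewrite expr0 mul1r.
have r0 : 0 <= rho by rewrite ltW // (lt_trans ltr01).
have [C C0 HC] := expn_le_geometric k r1.
have [B HB] := ws.
apply: (@tot_right _ N (C * rho ^+ N * B) _ _ _).1 => [j|j jN|L].
- by rewrite mulr_ge0 // exprn_ge0.
- by rewrite wN // mulr0.
apply: le_trans (ler_wpM2l _ (HB L)); last by rewrite mulr_ge0 ?exprn_ge0.
rewrite mulr_sumr; apply: ler_sum => n _.
rewrite [X in _ <= _ * X]ger0_norm; last by rewrite mulr_ge0 // sqr_ge0.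
rewrite [X in _ <= X]mulrCA [X in X <= _]mulrC ler_wpM2l //.
apply: (@le_trans _ _ ((N + n)%N%:R ^+ k)).
  rewrite lerXn2r ?nnegrE // -intr_norm [X in _ <= X]pmulrn ler_int; lia.
apply: le_trans (HC _) _; rewrite exprD mulrA ler_wpM2l ?mulr_ge0 ?exprn_ge0 //.
by rewrite expr2 ler_peMl ?exprn_ge0 // exprn_ege1 // ltW.
Qed.

Lemma exp_tails_mom w K : (forall j, 0 <= w j) -> exp_tails w -> mom K w.
Proof.
move=> w0 [wr|wr]; first exact: exp_right_mom.
have [m0 mK] := exp_right_mom K (fun j => w0 (- j)) wr.
split.
  by have := sbl_refl m0; under eq_fun do rewrite opprK.
have := sbl_refl mK; under eq_fun do rewrite opprK mulrNz normrN.
by [].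
Qed.

Lemma exp_right_dense w h e : (forall j, 0 <= w j) -> exp_right w ->
  sbl (fun j => w j * h j ^+ 2) -> 0 < e -> exists u : {poly R},
  sbl (fun j => w j * (h j - u.[j%:~R]) ^+ 2) /\
  tot (fun j => w j * (h j - u.[j%:~R]) ^+ 2) <= e.
Proof.
move=> w0 [N [rho [r1 wN ws]]] hs e0.
have hb : bsum (fun n : nat => w (n%:Z - N%:Z) * h (n%:Z - N%:Z) ^+ 2).
  apply/(bsum_drop N); apply: bsum_le hs.1 _ => n.
  by rewrite (_ : (N + n)%N%:Z - N%:Z = n%:Z) //; lia.
have [u ue] := @polynomials_dense _ (fun n : nat => w (n%:Z - N%:Z)) rho
  (fun n => w0 _) r1 ws (fun n => h (n%:Z - N%:Z)) hb e e0.
exists (pshift N%:R u); apply: (@tot_right _ N) => [j|j jN|L].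
- by rewrite mulr_ge0 // sqr_ge0.
- by rewrite wN // mul0r.
apply: le_trans (ue L); apply: ler_sum => n _.
by rewrite pshiftE intrD mulrNz subrK.
Qed.

Lemma exp_tails_dense w h e : (forall j, 0 <= w j) -> exp_tails w ->
  sbl (fun j => w j * h j ^+ 2) -> 0 < e -> exists u : {poly R},
  sbl (fun j => w j * (h j - u.[j%:~R]) ^+ 2) /\
  tot (fun j => w j * (h j - u.[j%:~R]) ^+ 2) <= e.
Proof.
move=> w0 [wr|wr] hs e0; first exact: exp_right_dense.
have [u [us ue]] := exp_right_dense (fun j => w0 (- j)) wr (sbl_refl hs) e0.
exists (u \Po (- 'X)).
have E : (fun j => w j * (h j - (u \Po (- 'X)).[j%:~R]) ^+ 2) =
    (fun j : int => w (- - j) * (h (- - j) - u.[(- j)%:~R]) ^+ 2).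
  by apply/funext => j; rewrite opprK horner_comp !hornerE mulrNz.
rewrite E; split; first exact: (sbl_refl us).
by rewrite (tot_refl us).
Qed.

Lemma exp_right_ratio w (a1 a0 b0 : R) : (forall j, 0 <= w j) -> - 1 < a1 ->
  (forall j : int, (a1 * j%:~R + a0) * w j =
     ((a1 + 1) * (j + 1)%:~R + b0) * w (j + 1)) ->
  (forall j : int, 0 <= (a1 * j%:~R + a0) * w j) -> exp_right w.
Proof.
move=> w0 a1_gt w_rec w_pos.
have a10 : 0 < a1 + 1 by lra.
have a20 : 0 < a1 + 2 by lra.
pose N := (Num.truncn (`|b0| / (a1 + 1))).+1.
have Nb : `|b0| < (a1 + 1) * N%:R.
  by rewrite mulrC -ltr_pdivrMr // truncnS_gt.
pose M := (Num.truncn ((a1 + 2) * (`|a0| + `|b0|))).+1.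
have Mb : (a1 + 2) * (`|a0| + `|b0|) < M%:R by exact: truncnS_gt.
(* The quotient of the two linear factors tends to [a1 / (a1 + 1)], which is below [r] because
   [r * (a1 + 1) - a1 = (a1 + 2)^-1]. [M] is where this margin outweighs [a0] and [b0]. *)
pose r := (a1 + 1) / (a1 + 2).
have r0 : 0 <= r by rewrite divr_ge0 ?ltW.
have r1 : r < 1 by rewrite ltr_pdivrMr //; lra.
(* For [j < - N] the right-hand factor [(a1 + 1) * j + b0] is negative, whereas its product with
   [w j] is nonnegative. *)
have wN (j : int) : j < - N%:Z -> w j = 0.
  move=> jN; have := w_pos (j - 1); rewrite w_rec subrK => h.
  apply/eqP; rewrite eq_le w0 andbT leNgt; apply/negP => wj.
  move: h; rewrite pmulr_lge0 // leNgt => /negP; apply.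
  have : j%:~R < - N%:R :> R by rewrite [N%:R]pmulrn -mulrNz ltr_int.
  rewrite -(ltr_pM2l a10) => h; have := ler_norm b0; lra.
have step (j : int) : (N + M)%N%:Z <= j -> w (j + 1) <= r * w j.
  move=> jM; have jR : N%:R + M%:R <= j%:~R :> R.
    by rewrite -natrD [(N + M)%:R]pmulrn ler_int.
  have N0 : 0 <= N%:R :> R by [].
  have M0 : 0 <= M%:R :> R by [].
  have d0 : 0 < (a1 + 1) * (j + 1)%:~R + b0.
    have : (a1 + 1) * N%:R <= (a1 + 1) * (j + 1)%:~R.
      by rewrite ler_wpM2l ?(ltW a10) // intrD; lra.
    by have := ler_norm (- b0); rewrite normrN; lra.
  rewrite -(ler_pM2l d0) -w_rec mulrCA mulrA ler_wpM2r //.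
  have e : r * (a1 + 1) - a1 = (a1 + 2)^-1.
    by rewrite /r; field; exact: lt0r_neq0.
  have h1 : `|a0| + `|b0| < (a1 + 2)^-1 * j%:~R.
    by rewrite mulrC ltr_pdivlMr // mulrC; lra.
  rewrite -e in h1.
  have h2 : - `|b0| <= r * b0.
    rewrite lerNl -mulrN; apply: le_trans (ler_norm _) _.
    by rewrite normrM normrN (ger0_norm r0) ler_piMl // ltW.
  have h3 : 0 <= r * (a1 + 1) by rewrite mulr_ge0 // ltW.
  have := ler_norm a0; rewrite mulrDr intrD; lra.
have vr n : (N + (N + M) <= n)%N -> w (n.+1%:Z - N%:Z) <= r * w (n%:Z - N%:Z).
  move=> Nn; have -> : n.+1%:Z - N%:Z = n%:Z - N%:Z + 1 by lia.
  by apply: step; lia.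
have [rho r1' ws] := bsum_ratio (fun n => w0 (n%:Z - N%:Z)) r0 r1 vr.
by exists N, rho.
Qed.

End exponential_tails.

(** * Geometric tails in the Cumulative Ord family *)

Section weight_tails.
Variable R : realType.
Variables (delta beta gamma mu : R) (p : int -> R) (K : nat).
Hypothesis p_rec : forall j, (qpoly delta beta gamma).[j%:~R] * p j =
  (rpoly delta beta gamma mu).[(j + 1)%:~R] * p (j + 1).
Hypothesis p_ge0 : forall j, 0 <= p j.
Hypothesis p_mom : mom K p.
Hypothesis K_ge2 : (2 <= K)%N.
Local Notation wt := (wt delta beta gamma p).

Lemma exp_tails_bounded (N : nat) i : (forall j : int, N%:Z <= `|j| -> p j = 0) ->
  exp_tails (wt i).
Proof.
move=> pN; left; exists N, 2; split; first by rewrite ltr1n.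
  by move=> j jN; rewrite wt_eq0 // pN //; lia.
apply: (@bsum_eventually0 _ _ (N + N)) => n Nn.
by rewrite wt_eq0 ?mul0r // pN //; lia.
Qed.

(** If [delta < 0], the sign of [wt 1] forces [q >= 0] on the support, and [q] is a downward
    parabola, so the support is bounded. If [delta = 0], the factors of the recurrence are linear
    and the sign of [beta + 1] decides which side is the half-line. *)
Lemma wt_exp_tails i :
  delta <= 0 \/ (exists N : nat, forall j : int, N%:Z <= `|j| -> p j = 0) ->
  exp_tails (wt i).
Proof.
have w0 i' j : 0 <= wt i' j by apply: wt_ge0 p_rec p_ge0 p_mom K_ge2 i' j.
case=> [|[N pN]]; last exact: exp_tails_bounded pN.
rewrite le_eqVlt => /orP[/eqP d0|d0].
  have [b1|b1] := ltP (- 1) beta.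
    left; apply: (@exp_right_ratio _ _ beta (gamma + beta * i%:R) (gamma - mu)) => // j.
      have := wtS_right p_rec i j; rewrite wtS => h.
      transitivity ((qpoly delta beta gamma).[(j + i%:Z)%:~R] * wt i j).
        by rewrite /qpoly !hornerE /= d0 intrD; congr (_ * _); rewrite -pmulrn; ring.
      rewrite h /rpoly /qpoly !hornerE /= d0; congr (_ * _); ring.
    have := w0 i.+1 j; rewrite wtS /qpoly !hornerE /= d0 intrD -pmulrn.
    by congr (0 <= _ * _); ring.
  (* Reflection exchanges the roles of [q] and [rpoly] and turns the slope [beta] into [- beta - 1],
     which is nonnegative here. *)
  right; apply: (@exp_right_ratio _ _ (- beta - 1) (gamma - mu) (gamma + beta * i%:R)) => //.
  - by lra.
  - move=> j; have := wtS_right p_rec i (- j - 1); rewrite wtS subrK => h.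
    transitivity ((rpoly delta beta gamma mu).[(- j)%:~R] * wt i (- j)).
      by rewrite /rpoly /qpoly !hornerE /= d0 mulrNz; congr (_ * _); ring.
    rewrite -h opprD /qpoly !hornerE /= d0 !intrD !mulrNz -pmulrn; congr (_ * _).
    ring.
  - move=> j; have := w0 i.+1 (- j - 1); rewrite (wtS_right p_rec) subrK.
    rewrite /rpoly /qpoly !hornerE /= d0 mulrNz.
    by congr (0 <= _ * _); ring.
pose N := (Num.truncn ((`|beta| + `|gamma|) / - delta)).+2.
apply: (@exp_tails_bounded N) => j Nj.
have nd : 0 < - delta by rewrite oppr_gt0.
have xN : 1 <= `|j%:~R| :> R.
  by rewrite -intr_norm ler1z; lia.
have xb : `|beta| + `|gamma| < - delta * `|j%:~R|.
  rewrite mulrC -ltr_pdivrMr //.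
  apply: lt_le_trans (truncnS_gt _) _.
  rewrite [_.+1%:R]pmulrn -intr_norm ler_int.
  by move: Nj; rewrite /N; set t := Num.truncn _; lia.
apply/eqP; rewrite eq_le p_ge0 andbT leNgt; apply/negP => pj.
have := w0 1%N j; rewrite wtS wt0 addr0 pmulr_lge0 // leNgt => /negP; apply.
rewrite /qpoly !hornerE /=; set x := j%:~R in xN xb *.
have hx : `|x| * `|x| = x * x by rewrite -normrM ger0_norm // -expr2 sqr_ge0.
have x0 : 0 < `|x| by lra.
have h1 : (`|beta| + `|gamma|) * `|x| < - delta * `|x| * `|x| by rewrite ltr_pM2r.
have h2 : beta * x <= `|beta| * `|x| by rewrite -normrM ler_norm.
have h3 : gamma <= `|gamma| * `|x|.
  by rewrite (le_trans (ler_norm _)) // ler_peMr.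
move: h1; rewrite -mulrA hx; lra.
Qed.

End weight_tails.

(** * Iterated differences of a polynomial *)

Section polynomial_differences.
Variable R : realType.
Implicit Types (u : {poly R}).

Lemma fdiffn_poly m a u j : lead_at m a u ->
  fdiffn m (fun j => u.[j%:~R]) j = m`!%:R * a.
Proof.
elim: m a u => [|m IH] a u [su <-].
  by rewrite /= [u]size1_polyC // hornerC coefC eqxx mul1r.
rewrite /fdiffn iterSr -/(fdiffn m _).
have -> : fdiff (fun j => u.[j%:~R]) = (fun j => (pshift 1 u - u).[j%:~R]).
  by apply/funext => x; rewrite /fdiff hornerD hornerN pshiftE intrD.
rewrite (IH (m.+1%:R * u`_m.+1)).
  by rewrite factS natrM; ring.
split; first exact: size_pshift_sub.
by rewrite coef_pshift_sub // mul1r.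
Qed.

End polynomial_differences.

(** * Orthogonality, Bessel and Parseval at a fixed level [i] *)

Section parseval.
Variable R : realType.
Variables (delta beta gamma mu : R) (p : int -> R).
Hypothesis p_rec : forall j, (qpoly delta beta gamma).[j%:~R] * p j =
  (rpoly delta beta gamma mu).[(j + 1)%:~R] * p (j + 1).
Hypothesis p_ge0 : forall j, 0 <= p j.
Hypothesis p_mom : forall K, mom K p.
Implicit Types (u : {poly R}) (h : int -> R) (a : nat -> R).
Local Notation wt := (wt delta beta gamma p).
Local Notation rodpoly := (rodpoly delta beta gamma mu).

Let w_ge0 i j : 0 <= wt i j.
Proof. exact: (wt_ge0 p_rec p_ge0 (p_mom 2) isT). Qed.

Lemma sbl_poly_wt u i : sbl (fun j => u.[j%:~R] * wt i j).
Proof. by apply: (@sbl_wt _ _ _ _ p _ (p_mom (size u + 2 * i + 2)%N)); lia. Qed.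

Variable i : nat.

(** Summation by parts moves [m] differences onto [u], leaving a constant. The case [c = 0] is
    orthogonality to lower degrees; [u = rodpoly m i] gives the norm. *)
Lemma tot_rodpoly_poly m c u : lead_at m c u ->
  tot (fun j => (rodpoly m i).[j%:~R] * wt i j * u.[j%:~R]) =
  m`!%:R * c * tot (wt (i + m)).
Proof.
move=> uc; pose K := (2 * (i + m) + 2)%N.
have E : (fun j => (rodpoly 0 (i + m)).[j%:~R] * wt (i + m) j *
      fdiffn m (fun j => u.[j%:~R]) j) =
    (fun j => m`!%:R * c * (1.[j%:~R] * wt (i + m) j)).
  by apply/funext => j; rewrite (fdiffn_poly _ uc) /= !hornerC; ring.
have K2 : (2 <= K)%N by rewrite /K; lia.
have [|_] := @rodpoly_parts _ _ _ _ _ _ _ p_rec p_ge0 (p_mom K) K2 0 m i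
  (fun j => u.[j%:~R]) ltac:(rewrite /K; lia).
  by rewrite E; apply: sblZ; exact: sbl_poly_wt.
rewrite add0n E => ->; rewrite totZ; last exact: sbl_poly_wt.
by congr (_ * tot _); apply/funext => j; rewrite hornerC mul1r.
Qed.

Lemma rodpoly_orthogonal m n : m != n ->
  tot (fun j => (rodpoly m i).[j%:~R] * wt i j * (rodpoly n i).[j%:~R]) = 0.
Proof.
wlog nm : m n / (n < m)%N => [H mn|_].
  have [nm|mn'] := ltnP n m; first exact: H.
  have : (m < n)%N by rewrite ltn_neqAle mn.
  move=> /H <-; last by rewrite eq_sym.
  by congr tot; apply/funext => j; ring.
rewrite (@tot_rodpoly_poly m 0) ?mulr0 ?mul0r //.
by apply: lead_at_small; apply: leq_trans nm; exact: size_rodpoly.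
Qed.

Definition rodnorm m :=
  tot (fun j => (rodpoly m i).[j%:~R] * wt i j * (rodpoly m i).[j%:~R]).

Lemma rodnormE m :
  rodnorm m = m`!%:R * Pi_ delta m (m.-1 + 2 * i) * tot (wt (i + m)).
Proof. by rewrite /rodnorm (tot_rodpoly_poly (lead_at_rodpoly _ _ _ _ _ _)). Qed.

Variable h : int -> R.
Hypothesis h_L2 : sbl (fun j => wt i j * h j ^+ 2).

Lemma sbl_poly_L2 u : sbl (fun j => u.[j%:~R] * wt i j * h j).
Proof.
apply: sbl_le (sblD (sbl_poly_wt (u * u) i) h_L2) _ => j.
have w0 := w_ge0 i j; set x := h j; set y := u.[_].
rewrite hornerM -/y [leRHS]ger0_norm; last first.
  by apply: addr_ge0; apply: mulr_ge0 => //; [rewrite -expr2|]; exact: sqr_ge0.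
have -> : y * y * wt i j + wt i j * x ^+ 2 = wt i j * (y ^+ 2 + x ^+ 2) by ring.
rewrite [y * _]mulrC -mulrA normrM (ger0_norm w0) ler_wpM2l //.
have := sqr_ge0 (`|x| - `|y|).
rewrite sqrrB !real_normK ?num_real // normrM; have := normr_ge0 x.
have := normr_ge0 y; have : 0 <= `|x| * `|y| by rewrite mulr_ge0.
lra.
Qed.

Lemma sbl_residual u : sbl (fun j => wt i j * (h j - u.[j%:~R]) ^+ 2).
Proof.
have -> : (fun j => wt i j * (h j - u.[j%:~R]) ^+ 2) = (fun j =>
    (wt i j * h j ^+ 2 + -2 * (u.[j%:~R] * wt i j * h j)) + (u * u).[j%:~R] * wt i j).
  by apply/funext => j; rewrite hornerM; ring.
by apply: sblD; [apply: sblD => //; apply: sblZ; exact: sbl_poly_L2|exact: sbl_poly_wt].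
Qed.

Definition fourier m := tot (fun j => (rodpoly m i).[j%:~R] * wt i j * h j).

Definition rodsum a K : {poly R} := \sum_(m < K) a m *: rodpoly m i.

Lemma rodsumS a K : rodsum a K.+1 = rodsum a K + a K *: rodpoly K i.
Proof. by rewrite /rodsum big_ord_recr. Qed.

Lemma tot_rodpoly_rodsum a K n : (K <= n)%N ->
  tot (fun j => (rodpoly n i).[j%:~R] * wt i j * (rodsum a K).[j%:~R]) = 0.
Proof.
elim: K => [_|K IH Kn].
  rewrite -[RHS](tot0 R); congr tot; apply/funext => j.
  by rewrite /rodsum big_ord0 horner0 mulr0.
have -> : (fun j => (rodpoly n i).[j%:~R] * wt i j * (rodsum a K.+1).[j%:~R]) =
  (fun j => (rodpoly n i).[j%:~R] * wt i j * (rodsum a K).[j%:~R] +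
    a K * ((rodpoly n i).[j%:~R] * wt i j * (rodpoly K i).[j%:~R])).
  by apply/funext => j; rewrite rodsumS hornerD hornerZ; ring.
have s u v : sbl (fun j => u.[j%:~R] * wt i j * v.[j%:~R]).
  have := sbl_poly_wt (u * v) i; congr sbl; apply/funext => j.
  by rewrite hornerM; ring.
rewrite totD; [|exact: s|by apply: sblZ; exact: s].
rewrite totZ; last exact: s.
by rewrite IH ?(ltnW Kn) // rodpoly_orthogonal ?mulr0 ?addr0 // gtn_eqF.
Qed.

Lemma residual_norm a K :
  tot (fun j => wt i j * (h j - (rodsum a K).[j%:~R]) ^+ 2) =
  tot (fun j => wt i j * h j ^+ 2) +
  \sum_(m < K) (a m ^+ 2 * rodnorm m - 2 * a m * fourier m).
Proof.
elim: K => [|K IH].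
  rewrite big_ord0 addr0; congr tot; apply/funext => j.
  by rewrite /rodsum big_ord0 horner0 subr0.
rewrite big_ord_recr /= addrA -IH.
have s u v : sbl (fun j => u.[j%:~R] * wt i j * v.[j%:~R]).
  have := sbl_poly_wt (u * v) i; congr sbl; apply/funext => j.
  by rewrite hornerM; ring.
have -> : (fun j => wt i j * (h j - (rodsum a K.+1).[j%:~R]) ^+ 2) = (fun j =>
    (wt i j * (h j - (rodsum a K).[j%:~R]) ^+ 2 +
     a K ^+ 2 * ((rodpoly K i).[j%:~R] * wt i j * (rodpoly K i).[j%:~R])) +
    (- (2 * a K) * ((rodpoly K i).[j%:~R] * wt i j * h j) +
     2 * a K * ((rodpoly K i).[j%:~R] * wt i j * (rodsum a K).[j%:~R]))).
  by apply/funext => j; rewrite rodsumS hornerD hornerZ; ring.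
rewrite totD; last 2 first.
- by apply: sblD; [exact: sbl_residual|apply: sblZ; exact: s].
- by apply: sblD; apply: sblZ; [exact: sbl_poly_L2|exact: s].
rewrite totD; [|exact: sbl_residual|by apply: sblZ; exact: s].
rewrite totD; [|by apply: sblZ; exact: sbl_poly_L2|by apply: sblZ; exact: s].
rewrite (totZ (a K ^+ 2)); last exact: s.
rewrite (totZ (- (2 * a K))); last exact: sbl_poly_L2.
rewrite (totZ (2 * a K)); last exact: s.
by rewrite tot_rodpoly_rodsum // -/(rodnorm K) -/(fourier K); ring.
Qed.

Lemma rodnorm_ge0 m : 0 <= rodnorm m.
Proof.
apply: tot_ge0 => [|j].
  have := sbl_poly_wt (rodpoly m i * rodpoly m i) i; congr sbl.
  by apply/funext => j; rewrite hornerM; ring.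
by rewrite mulrAC -expr2 mulr_ge0 // sqr_ge0.
Qed.

(** The terms of [rodnorm m] are nonnegative, so a zero sum makes [rodpoly m i] vanish wherever
    [wt i] does not. *)
Lemma fourier_eq0 m : rodnorm m = 0 -> fourier m = 0.
Proof.
move=> N0; rewrite -[RHS](tot0 R) /fourier; congr tot; apply/funext => j.
have : (rodpoly m i).[j%:~R] * wt i j * (rodpoly m i).[j%:~R] <= 0.
  rewrite -N0 /rodnorm; apply: (@le_tot_term _ (fun j =>
    (rodpoly m i).[j%:~R] * wt i j * (rodpoly m i).[j%:~R]) j).
    have := sbl_poly_wt (rodpoly m i * rodpoly m i) i; congr sbl.
    by apply/funext => x; rewrite hornerM; ring.
  by move=> x; rewrite mulrAC -expr2 mulr_ge0 // sqr_ge0.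
rewrite mulrAC -expr2 => h0.
have /eqP : (rodpoly m i).[j%:~R] ^+ 2 * wt i j == 0.
  by rewrite eq_le h0 mulr_ge0 // sqr_ge0.
by move/eqP; rewrite mulf_eq0 sqrf_eq0 => /orP[] /eqP ->; rewrite ?mulr0 !mul0r.
Qed.

(* Where [rodnorm] vanishes the quotient is [0], so that no truncation at the
   size of the support is needed. *)
Lemma bessel K :
  \sum_(m < K) fourier m ^+ 2 / rodnorm m <= tot (fun j => wt i j * h j ^+ 2).
Proof.
have := residual_norm (fun m => fourier m / rodnorm m) K.
have : 0 <= tot (fun j => wt i j *
    (h j - (rodsum (fun m => fourier m / rodnorm m) K).[j%:~R]) ^+ 2).
  by apply: tot_ge0 => [|j]; [exact: sbl_residual|rewrite mulr_ge0 // sqr_ge0].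
move=> + e; rewrite {}e.
have -> : \sum_(m < K) ((fourier m / rodnorm m) ^+ 2 * rodnorm m -
    2 * (fourier m / rodnorm m) * fourier m) =
    - \sum_(m < K) fourier m ^+ 2 / rodnorm m.
  rewrite -sumrN; apply: eq_bigr => m _.
  have [->|N0] := eqVneq (rodnorm m) 0; first by rewrite invr0; ring.
  by field.
by rewrite subr_ge0.
Qed.

(** Completing the square in each [a m]. *)
Lemma best_approximation a K : tot (fun j => wt i j * h j ^+ 2) <=
  \sum_(m < K) fourier m ^+ 2 / rodnorm m +
  tot (fun j => wt i j * (h j - (rodsum a K).[j%:~R]) ^+ 2).
Proof.
rewrite residual_norm addrCA lerDl -big_split; apply: sumr_ge0 => m _ /=.
have [N0|N0] := eqVneq (rodnorm m) 0.
  by rewrite fourier_eq0 // N0 !mulr0 subr0 expr0n mul0r addr0.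
have Np : 0 < rodnorm m by rewrite lt_def N0 rodnorm_ge0.
have -> : fourier m ^+ 2 / rodnorm m + (a m ^+ 2 * rodnorm m - 2 * a m * fourier m)
    = (fourier m - a m * rodnorm m) ^+ 2 / rodnorm m by field.
by rewrite divr_ge0 ?sqr_ge0 // ltW.
Qed.

(** Triangularity: the condition gives [rodpoly m i] exact degree [m], so leading terms can be
    removed one by one. *)
Lemma rodsum_expand K u : (forall m, (m < K)%N -> Pi_ delta m (m.-1 + 2 * i) != 0) ->
  (size u <= K)%N -> exists a, u = rodsum a K.
Proof.
elim: K u => [|K IH] u L0 su.
  exists (fun=> 0); move: su; rewrite leqn0 size_poly_eq0 => /eqP ->.
  by rewrite /rodsum big_ord0.
have LK := L0 K (ltnSn K); set l := Pi_ _ _ _ in LK.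
have [sR cR] := lead_at_rodpoly delta beta gamma mu K i.
have [||a aE] := IH (u - (u`_K / l) *: rodpoly K i).
- by move=> m mK; apply: L0; exact: ltnW.
- apply/leq_sizeP => n; rewrite leq_eqVlt => /orP[/eqP <-|Kn].
    by rewrite coefB coefZ cR divfK // subrr.
  rewrite coefB coefZ (nth_default 0 (leq_trans su Kn)).
  by rewrite (nth_default 0 (leq_trans sR Kn)) mulr0 subr0.
exists (fun m => if m == K then u`_K / l else a m).
rewrite rodsumS eqxx -[LHS](subrK ((u`_K / l) *: rodpoly K i)) aE; congr (_ + _).
by apply: eq_bigr => m _; rewrite ltn_eqF.
Qed.

Lemma wt_Pi_gt0 m j : 0 < wt (i + m) j -> 0 < Pi_ delta m (m.-1 + 2 * i).
Proof.
case: m => [_|m wj]; first by rewrite /Pi_ big_geq.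
rewrite addnS in wj.
apply: (Pi_gt0 p_rec p_ge0 (p_mom (2 * (i + m).+1)%N) _ (leqnn _) wj) => /=; lia.
Qed.

Lemma residual_eq u v : (forall j, 0 < wt i j -> u.[j%:~R] = v.[j%:~R]) ->
  (fun j => wt i j * (h j - u.[j%:~R]) ^+ 2) = (fun j => wt i j * (h j - v.[j%:~R]) ^+ 2).
Proof.
move=> uv; apply/funext => j; have [->|w0] := eqVneq (wt i j) 0.
  by rewrite !mul0r.
by rewrite uv // lt_def w0 w_ge0.
Qed.

(* The hypotheses say that the support of [wt i] consists of the [K + 1] points
   from [j0] on; [v] is the remainder of [u] modulo their monic polynomial. *)
Lemma reduce_degree u K j0 : 0 < wt (i + K) j0 ->
  (forall j, ~ 0 < wt (i + K.+1) j) ->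
  exists2 v : {poly R}, (size v <= K.+1)%N
    & forall j, 0 < wt i j -> u.[j%:~R] = v.[j%:~R].
Proof.
have wP n j : (0 < wt n j) = (0 < p j) && (0 < p (j + n%:Z)).
  exact: (wt_gt0P p_rec p_ge0 (p_mom 2) isT).
have pI l j r : l <= j -> j <= r -> 0 < p l -> 0 < p r -> 0 < p j.
  exact: (supp_interval p_rec p_ge0 (p_mom 2) isT).
rewrite wP => /andP[p0 pK] wK.
have gap x y : 0 < p x -> 0 < p y -> y - x <= (i + K)%N%:Z.
  move=> px py; rewrite leNgt; apply/negP => xy; apply: (wK x); rewrite wP px /=.
  by apply: (pI x _ y) => //; lia.
pose D : {poly R} := \prod_(l < K.+1) ('X - (j0 + l%:Z)%:~R%:P).
have sD : size D = K.+2.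
  rewrite /D -(big_map (fun l : 'I_K.+1 => (j0 + l%:Z)%:~R) predT (fun x => 'X - x%:P)).
  by rewrite size_prod_XsubC size_map [index_enum _]unlock -enumT size_enum_ord.
exists (u %% D) => [|j]; first by rewrite -ltnS -sD ltn_modp -size_poly_gt0 sD.
rewrite wP => /andP[pj pji].
have := gap _ _ pj pK; have := gap _ _ p0 pji => h1 h2.
have [l lK ->] : exists2 l : nat, (l < K.+1)%N & j = j0 + l%:Z.
  by exists `|j - j0|%N; lia.
have D0 : D.[(j0 + l%:Z)%:~R] = 0.
  by rewrite horner_prod (bigD1 (Ordinal lK)) //= hornerXsubC subrr mul0r.
by rewrite {1}(divp_eq u D) hornerD hornerM D0 mulr0 add0r.
Qed.

Theorem parseval e : exp_tails (wt i) -> (exists j, 0 < wt i j) -> 0 < e ->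
  exists K, tot (fun j => wt i j * h j ^+ 2) <=
    \sum_(m < K) fourier m ^+ 2 / rodnorm m + e.
Proof.
move=> we wi e0; have [u [_ ue]] := exp_tails_dense (w_ge0 i) we h_L2 e0.
suff [K [v [L0 sv uv]]] : exists K (v : {poly R}),
    [/\ forall m, (m < K)%N -> Pi_ delta m (m.-1 + 2 * i) != 0, (size v <= K)%N
      & forall j, 0 < wt i j -> u.[j%:~R] = v.[j%:~R]].
  exists K; have [a va] := rodsum_expand L0 sv.
  apply: le_trans (best_approximation a K) _.
  by rewrite lerD2l -va -(residual_eq uv).
have [inf|] := pselect (forall m, exists j, 0 < wt (i + m) j).
  exists (size u), u; split=> // m _.
  by have [j /wt_Pi_gt0/lt0r_neq0] := inf m.
move=> /existsNP[m0 /forallNP m0P].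
have ex : exists m, `[< forall j, ~ 0 < wt (i + m) j >].
  by exists m0; apply/asboolP.
(* [K.+1] is the least number of levels above [i] at which the weight vanishes identically. Leading
   coefficients are known to be nonzero only up to index [K], so [u] gives way to a polynomial of
   degree at most [K] with the same values on the support of [wt i]. *)
case: (ex_minnP ex) => -[|K] /asboolP HK Kmin.
  by case: wi => j wj; case: (HK j); rewrite addn0.
have pos m : (m <= K)%N -> exists j, 0 < wt (i + m) j.
  move=> mK; apply: contrapT => /forallNP Hm.
  by have := Kmin m (asboolT Hm); rewrite leqNgt ltnS mK.
have [j0 wj0] := pos K (leqnn K).
have [v sv uv] := reduce_degree u wj0 HK.
exists K.+1, v; split=> // m mK.
by have [j /wt_Pi_gt0/lt0r_neq0] := pos m mK.
Qed.

End parseval.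

(** * Expectations as sums over the integers *)

Section point_masses.
Variable R : realType.
Implicit Types (f h : int -> R).

Lemma psum_point h (x : int) N : (`|x| < N)%N ->
  psum (fun j => h j * (x == j)%:R) N = h x.
Proof.
rewrite /psum big_split /=; case: x => m /= mN.
  rewrite (bigD1 (Ordinal mN)) //= eqxx mulr1 !big1 ?addr0 // => n.
    by rewrite mulr0.
  by rewrite -val_eqE /= eq_sym => /negbTE nm; rewrite eqz_nat nm mulr0.
have e2 n : (Negz m == - n.+1%:Z) = (n == m) by apply/eqP/eqP; lia.
have mN' : (m < N)%N by exact: ltnW.
rewrite big1 ?add0r; last by move=> n _; rewrite mulr0.
rewrite (bigD1 (Ordinal mN')) //= e2 eqxx mulr1 big1 ?addr0 ?NegzE // => n.
by rewrite -val_eqE /= e2 => /negbTE ->; rewrite mulr0.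
Qed.

Lemma sbl_psum_le f B : (forall j, 0 <= f j) -> (forall N, psum f N <= B) -> sbl f.
Proof.
move=> f0 fB; split.
  exists B => L; apply: le_trans (fB L); apply: ler_sum => n _.
  by rewrite ger0_norm // lerDl.
apply/(bsum_drop 1); exists B => L; apply: le_trans (fB L).
by apply: ler_sum => n _; rewrite ger0_norm // add1n lerDr.
Qed.

End point_masses.

Section expectation.
Context d (T : measurableType d) (R : realType) (P : probability T R).
Variable X : {RV P >-> int}.
Implicit Types h : int -> R.
Local Open Scope ereal_scope.
Local Notation p := (ipmf X).

Lemma ipmf_ge0 j : (0 <= p j)%R.
Proof. by rewrite fine_ge0. Qed.

Lemma measurable_int_comp h : measurable_fun setT (fun t => h (X t)).
Proof. exact: (@measurableT_comp _ _ _ _ _ _ h). Qed.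

Lemma integral_point (j : int) (c : R) : (0 <= c)%R ->
  \int[P]_t (c * (X t == j)%:R)%:E = (c * p j)%:E.
Proof.
move=> c0; have mA : measurable (X @^-1` [set j]).
  by rewrite -[X in measurable X]setTI; apply: measurable_funPT.
under eq_integral do rewrite EFinM.
rewrite ge0_integralZl_EFin //; last first.
  by apply/measurable_EFinP; exact: (measurable_int_comp (fun x => (x == j)%:R)).
rewrite (eq_integral (fun t => (\1_(X @^-1` [set j]) t)%:E)); last first.
  move=> t _; rewrite indicE; congr ((nat_of_bool _)%:R%:E).
  by apply/eqP/idP => [Xt|/set_mem//]; exact/mem_set.
by rewrite integral_indic // setIT EFinM fineK // fin_num_measure.
Qed.

(** [h (X t)] is a series over the possible values of [X], in the order of [psum], with at most one
    nonzero summand; monotone convergence integrates it termwise. *)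
Lemma Ex_nneseries h : (forall j, 0 <= h j)%R ->
  Ex X h = \sum_(0 <= n <oo) (h n%:Z * p n%:Z + h (- n.+1%:Z) * p (- n.+1%:Z))%:E.
Proof.
move=> h0; rewrite /Ex unlock.
pose u (n : nat) t : R :=
  (h n%:Z * (X t == n%:Z)%:R + h (- n.+1%:Z) * (X t == - n.+1%:Z)%:R)%R.
have u0 n t : (0 <= u n t)%R by rewrite addr_ge0 // mulr_ge0.
have mX j : measurable_fun setT (fun t => h j * (X t == j)%:R)%R.
  exact: (measurable_int_comp (fun x => h j * (x == j)%:R)%R).
transitivity (\int[P]_t (\sum_(0 <= n <oo) (u n t)%:E)).
  apply: eq_integral => t _; apply/esym/cvg_lim => //.
  apply: (@cvg_near_cst _ _ _ _ (nbhs \oo)); exists `|X t|.+1 => // N /= tN.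
  by rewrite sumEFin big_mkord -(psum_point h tN).
rewrite integral_nneseries //; last 2 first.
- move=> n; apply/measurable_EFinP; apply: measurable_funD; exact: mX.
- by move=> n t _; rewrite lee_fin.
apply: eq_eseriesr => n _.
rewrite /u; under eq_integral do rewrite EFinD.
rewrite ge0_integralD //; try by move=> t _; rewrite lee_fin mulr_ge0.
- by rewrite !integral_point.
- by apply/measurable_EFinP; exact: mX.
- by apply/measurable_EFinP; exact: mX.
Qed.

Lemma Ex_ge0_tot h : (forall j, 0 <= h j)%R -> sbl (fun j => h j * p j)%R ->
  Ex X h = (tot (fun j => h j * p j)%R)%:E.
Proof.
move=> h0 hs; rewrite Ex_nneseries //; apply/cvg_lim => //.
have -> : (fun N => \sum_(0 <= n < N) (h n%:Z * p n%:Z + h (- n.+1%:Z) * p (- n.+1%:Z))%:E)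
    = EFin \o psum (fun j => h j * p j)%R.
  by apply/funext => N; rewrite /= sumEFin big_mkord.
by apply: cvg_EFin; [exact: nearW|exact: psum_cvg hs].
Qed.

Lemma Ex_lty_sbl h : (forall j, 0 <= h j)%R -> Ex X h < +oo -> sbl (fun j => h j * p j)%R.
Proof.
move=> h0 hoo; have hp0 j : (0 <= h j * p j)%R by rewrite mulr_ge0 ?ipmf_ge0.
apply: (@sbl_psum_le _ _ (fine (Ex X h))) => // N.
have E0 : 0 <= Ex X h by rewrite /Ex expectation_ge0.
rewrite -lee_fin fineK ?ge0_fin_numE // Ex_nneseries //.
apply: le_trans (@nneseries_lim_ge _ _ xpredT 0%N N _).
  by rewrite sumEFin big_mkord.
by move=> n _ _; rewrite lee_fin addr_ge0.
Qed.

Lemma has_Ex_sbl h : has_Ex X h <-> sbl (fun j => h j * p j)%R.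
Proof.
have E : \int[P]_t `|(h (X t))%:E| = Ex X (fun j => `|h j|%R) by rewrite /Ex unlock.
have m : measurable_fun setT (fun t => (h (X t))%:E).
  by apply/measurable_EFinP; exact: measurable_int_comp.
have n j : (`|h j * p j| = `|h j| * p j)%R by rewrite normrM (ger0_norm (ipmf_ge0 j)).
split=> [/integrableP[_]|hs].
  rewrite E => /Ex_lty_sbl => /(_ (fun j => normr_ge0 _)) hs.
  by apply: sbl_le hs _ => j; rewrite -n normr_id.
apply/integrableP; split=> //; rewrite E Ex_ge0_tot ?ltry //.
by apply: sbl_le hs _ => j; rewrite -n normr_id.
Qed.

Lemma Ex_tot h : sbl (fun j => h j * p j)%R -> Ex X h = (tot (fun j => h j * p j)%R)%:E.
Proof.
move=> hs; pose hp j := Num.max (h j) 0%R; pose hn j := Num.max (- h j)%R 0%R.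
have hpn j : (h j = hp j - hn j)%R.
  by rewrite /hp /hn; case: (ltrP (h j) 0); case: (ltrP (- h j) 0); lra.
have hp0 j : (0 <= hp j)%R by rewrite /hp le_max lexx orbT.
have hn0 j : (0 <= hn j)%R by rewrite /hn le_max lexx orbT.
have hps : sbl (fun j => hp j * p j)%R.
  apply: sbl_le hs _ => j; rewrite !normrM ler_wpM2r // ger0_norm //.
  by rewrite /hp ge_max normr_ge0 ler_norm.
have hns : sbl (fun j => hn j * p j)%R.
  apply: sbl_le hs _ => j; rewrite !normrM ler_wpM2r // ger0_norm //.
  by rewrite /hn ge_max normr_ge0 -normrN ler_norm.
transitivity (Ex X hp - Ex X hn).
  rewrite /Ex unlock -integralB_EFin //.
  - by apply: eq_integral => t _; rewrite -EFinB -hpn.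
  - exact/has_Ex_sbl.
  - exact/has_Ex_sbl.
rewrite !Ex_ge0_tot // -EFinB -totB //; congr (tot _)%:E.
by apply/funext => j; rewrite -mulrBl -hpn.
Qed.

Lemma sbl_ipmf : sbl p.
Proof.
have : sbl (fun j => (fun=> 1) j * p j)%R.
  by apply/has_Ex_sbl; apply/finite_measure_integrable_cst.
by move=> s1; apply: sbl_le s1 _ => j; rewrite mul1r.
Qed.

Lemma tot_ipmf : tot p = 1%R.
Proof.
have s1 : sbl (fun j => (fun=> 1%R) j * p j)%R.
  by apply: sbl_le sbl_ipmf _ => j; rewrite mul1r.
have := Ex_tot s1; rewrite /Ex (expectation_cst P 1) => -[->].
by congr tot; apply/funext => j; rewrite mul1r.
Qed.

End expectation.

(** * Cardinality of integer intervals *)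

Section interval_cardinality.

(** If no two points are at distance [m], [S] has a least element and fits into the [m] consecutive
    integers starting there. *)
Lemma card_le_intervalP (S : set int) m :
  (forall l j r, l <= j -> j <= r -> S l -> S r -> S j) -> S !=set0 ->
  (`I_m.+1 #<= S)%card <-> exists j, S j /\ S (j + m%:Z).
Proof.
move=> SI [x0 Sx0]; split=> [mS|[j [Sj Sjm]]]; last first.
  have If : {in `I_m.+1 &, injective (fun n : nat => j + n%:Z)}.
    by move=> a b _ _ /addrI [].
  apply: card_le_trans (subset_card_le (_ : (fun n : nat => j + n%:Z) @` `I_m.+1 `<=` S)).
    by have := inj_card_eq If; rewrite card_eq_sym => /card_eqPle[].
  by move=> _ [n /= nm <-]; apply: (SI j _ (j + m%:Z)) => //; lia.
apply: contrapT => /forallNP H.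
have far j r : S j -> S r -> r - j < m%:Z.
  move=> Sj Sr; rewrite ltNge; apply/negP => jr; apply: (H j); split=> //.
  by apply: (SI j _ r) => //; lia.
have ex : exists r : nat, `[< S (x0 - r%:Z) >]
  by exists 0%N; apply/asboolP; rewrite subr0.
have bd (r : nat) : `[< S (x0 - r%:Z) >] -> (r <= m)%N.
  by move=> /asboolP Sr; have := far _ _ Sr Sx0; lia.
case: (ex_maxnP ex bd) => r0 /asboolP Sr0 r0max.
have sub : S `<=` (fun n : nat => (x0 - r0%:Z) + n%:Z) @` `I_m.
  move=> j Sj; have h1 := far _ _ Sr0 Sj.
  have h2 : x0 - r0%:Z <= j.
    rewrite leNgt; apply/negP => jr.
    have := r0max `|x0 - j|%N; rewrite (_ : x0 - `|x0 - j|%N%:Z = j); last by lia.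
    by move=> /(_ (asboolT Sj)); lia.
  by pose x : int := j - (x0 - r0%:Z); exists `|x|%N; rewrite /x /=; lia.
have := card_le_trans mS (card_le_trans (subset_card_le sub) (card_image_le _ _)).
by rewrite card_le_II ltnn.
Qed.

Lemma finite_set_int_bounded (S : set int) : finite_set S ->
  exists N : nat, forall j, S j -> `|j| < N%:Z.
Proof.
move=> /finite_seqP[s ->]; pose M := \max_(j <- s) `|j|%N.
exists M.+1 => j /= js; have jM : (`|j| <= M)%N by exact: leq_bigmax_seq.
lia.
Qed.

End interval_cardinality.

(** * Rodrigues functions and normalizing constants *)

Section rodrigues.
Variable R : realType.
Variables (delta beta gamma mu : R) (p : int -> R).
Hypothesis p_rec : forall j, (qpoly delta beta gamma).[j%:~R] * p j =
  (rpoly delta beta gamma mu).[(j + 1)%:~R] * p (j + 1).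
Local Notation wt := (wt delta beta gamma p).
Local Notation rodpoly := (rodpoly delta beta gamma mu).
Local Notation q := (quad delta beta gamma).

Lemma fdiffnZ m (c : R) f j : fdiffn m (fun l => c * f l) j = c * fdiffn m f j.
Proof.
by elim: m j => [//|m IH] j; rewrite /fdiffn !iterS -/(fdiffn m _) /fdiff !IH mulrBr.
Qed.

(** Multiplying by the pmf removes the division in [rodrigues]; where the pmf vanishes both sides
    are [0]. The constants [c] and [C] let one statement serve [X] and every [X_i]. *)
Lemma rodrigues_mul_pmf (pi qi : int -> R) i m c C j : c != 0 ->
  (forall l, pi l = c * wt i l) ->
  (forall l, rising m qi l * pi l = C * wt (i + m) l) ->
  rodrigues pi qi m j * pi j = C * ((rodpoly m i).[j%:~R] * wt i j).
Proof.
move=> c0 piE qiE; rewrite /rodrigues.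
under [X in fdiffn m X]eq_fun do rewrite qiE.
rewrite fdiffnZ; have := rodrigues_wt p_rec m i 0 j.
under [X in fdiffn m X]eq_fun do rewrite subr0.
rewrite subr0 => ->; have [pj|pj] := eqVneq (pi j) 0.
  move: pj; rewrite piE => /eqP; rewrite mulf_eq0 (negbTE c0) /= => /eqP ->.
  by rewrite !mulr0.
have s2 : (-1) ^+ m * (-1) ^+ m = 1 :> R by rewrite -exprMn mulrNN mulr1 expr1n.
set y := (rodpoly m i).[_] * _.
transitivity (((-1) ^+ m * (-1) ^+ m) * (pi j / pi j) * (C * y)); first by ring.
by rewrite s2 divff // !mul1r.
Qed.

Lemma rising_q_ i m j : rising m (q_ delta q i) j =
  rising m q (j + i%:Z) / (1 - 2 * i%:R * delta) ^+ m.
Proof.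
rewrite /rising prodf_div prodr_const card_ord; congr (_ / _).
by apply: eq_bigr => l _; congr q; lia.
Qed.

Lemma wtD i m j : wt (i + m) j = rising m q (j + i%:Z) * wt i j.
Proof.
elim: m => [|m IH]; first by rewrite addn0 /rising big_ord0 mul1r.
rewrite addnS wtS IH mulrA; congr (_ * _).
rewrite /rising big_ord_recr /= mulrC; congr (_ * _).
by rewrite qpolyE; congr (_.[_%:~R]); lia.
Qed.

End rodrigues.

Section normalization.
Variable R : realType.
Implicit Types delta : R.

(** The second factor is the leading coefficient of [R_{k-i,i}]; the first is the one that survives
    in [v_]. *)
Lemma Pi_split delta i k : (i <= k)%N -> Pi_ delta k k.-1 =
  Pi_ delta i k.-1 * Pi_ delta (k - i) ((k - i).-1 + 2 * i).
Proof.
rewrite leq_eqVlt => /orP[/eqP ->|ik].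
  by rewrite subnn /Pi_ [X in _ * X]big_geq // mulr1.
rewrite /Pi_ (@big_cat_nat _ _ _ (i + k.-1)) /=; [|lia|lia].
by congr (_ * _); apply: congr_big_nat => //; lia.
Qed.

(** [1 - j delta_i] is [1 - (j + 2 i) delta] divided by [1 - 2 i delta]. The case [m = 0] stands
    apart because for [i = k] that divisor is not known to be nonzero. *)
Lemma c_delta_ delta i m : m = 0%N \/ 0 < 1 - 2 * i%:R * delta ->
  c_ (delta_ delta i) m =
  Pi_ delta m (m.-1 + 2 * i) / (1 - 2 * i%:R * delta) ^+ m.
Proof.
case=> [->|l0]; first by rewrite /c_ /Pi_ !big_geq // expr0 divr1.
have -> : (1 - 2 * i%:R * delta) ^+ m =
    \prod_(m.-1 <= j < m + m.-1) (1 - 2 * i%:R * delta).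
  by rewrite prodr_const_nat addnK.
rewrite /c_ /Pi_ addnA [X in X / _]big_addn addnK -prodf_div.
apply: eq_bigr => j _; rewrite /delta_ natrD natrM; field.
exact: lt0r_neq0.
Qed.

(** [kf] and [mf] stand for [k!] and [(k - i)!], [P1] and [P2] for the factors of [Pi_split], [Wk]
    and [Wi] for total masses of weights, [l] for a power of [1 - 2 i delta]. Both sides are
    nonnegative and have equal squares. *)
Lemma fourier_constant (kf mf P1 P2 Wk Wi l : R) : 0 < kf -> 0 < mf -> 0 < P1 ->
  0 < P2 -> 0 < Wk -> 0 < Wi -> 0 < l ->
  (Num.sqrt (mf * (P2 / l) * (l^-1 * (Wi^-1 * Wk))))^-1 * (l^-1 * Wi^-1) =
  Num.sqrt (kf * P1 / (mf * Wi)) * (Num.sqrt (kf * (P1 * P2) * Wk))^-1.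
Proof.
move=> kf0 mf0 P10 P20 Wk0 Wi0 l0.
have e1 : 0 < mf * (P2 / l) * (l^-1 * (Wi^-1 * Wk)).
  by rewrite !(mulr_gt0, divr_gt0) ?invr_gt0.
have e2 : 0 < kf * P1 / (mf * Wi) by rewrite divr_gt0 ?mulr_gt0.
have e3 : 0 < kf * (P1 * P2) * Wk by rewrite !mulr_gt0.
have li : 0 <= l^-1 * Wi^-1 by rewrite mulr_ge0 // invr_ge0 ltW.
have si (x : R) : 0 <= (Num.sqrt x)^-1 by rewrite invr_ge0 sqrtr_ge0.
apply/eqP; rewrite -(@eqrXn2 _ 2) ?(mulr_ge0 _ li) ?mulr_ge0 ?sqrtr_ge0 //.
rewrite !exprMn !exprVn !sqr_sqrtr ?ltW //; apply/eqP; field.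
by rewrite !lt0r_neq0.
Qed.

End normalization.

(** * The Cumulative Ord family and part (a) *)

Section CO_family.
Context d (T : measurableType d) (R : realType) (P : probability T R).
Variables (X : {RV P >-> int}) (mu delta beta gamma : R).
Local Notation p := (ipmf X).
Local Notation wt := (wt delta beta gamma p).
Local Notation rodpoly := (rodpoly delta beta gamma mu).
Local Notation q := (quad delta beta gamma).

Lemma CO_recurrence : CO X mu q -> forall j,
  (qpoly delta beta gamma).[j%:~R] * p j =
  (rpoly delta beta gamma mu).[(j + 1)%:~R] * p (j + 1).
Proof.
case=> _ _ co j; rewrite -qpolyE.
have c0 := co j; have := co (j + 1).
set u := (fun n : nat => _) => c1.
have {}c1 : series u n.+1 @[n --> \oo] --> q (j + 1) * p (j + 1).
  by rewrite (cvg_shiftS (series u)).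
have e : (fun n => series u n.+1) = (fun n => (mu - (j + 1)%:~R) * p (j + 1) +
    series (fun n : nat => (mu - (j - n%:Z)%:~R) * p (j - n%:Z)) n).
  apply/funext => n; rewrite /series /= big_nat_recl // /u subr0; congr (_ + _).
  apply: eq_bigr => l _.
  by rewrite (_ : j + 1 - l.+1%:Z = j - l%:Z) //; lia.
have c2 : series u n.+1 @[n --> \oo] --> (mu - (j + 1)%:~R) * p (j + 1) + q j * p j.
  by rewrite e; apply: cvgD => //; exact: cvg_cst.
have := cvg_unique _ c1 c2 => /(_ (@norm_hausdorff _ _) _); rewrite qpolyE.
by rewrite /rpoly hornerD hornerN hornerC hornerD hornerX; lra.
Qed.

Variable K : nat.
Hypothesis p_rec : forall j, (qpoly delta beta gamma).[j%:~R] * p j =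
  (rpoly delta beta gamma mu).[(j + 1)%:~R] * p (j + 1).
Hypothesis p_mom : mom K p.
Hypothesis K_ge2 : (2 <= K)%N.

Let p_ge0 := ipmf_ge0 X.

Let w_ge0 i j : 0 <= wt i j.
Proof. exact: (wt_ge0 p_rec p_ge0 p_mom K_ge2). Qed.

Lemma leM_wtP m : leM m X <-> exists j, 0 < wt m j.
Proof.
have SI : forall l j r, l <= j -> j <= r -> supp X l -> supp X r -> supp X j.
  by move=> l j r; exact: (supp_interval p_rec p_ge0 p_mom K_ge2).
have S0 : supp X !=set0.
  apply: contrapT => /forallNP S0.
  have : tot p = 0 :> R.
    rewrite -(tot0 R); congr tot; apply/funext => j; apply/eqP.
    by rewrite eq_le p_ge0 andbT leNgt; apply/negP; exact: S0.
  by rewrite tot_ipmf => /eqP; rewrite oner_eq0.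
rewrite /leM (card_le_intervalP _ SI S0); split=> -[j].
  by move=> [pj pjm]; exists j; rewrite (wt_gt0P p_rec p_ge0 p_mom K_ge2) pj.
by rewrite (wt_gt0P p_rec p_ge0 p_mom K_ge2) => /andP[pj pjm]; exists j.
Qed.

Lemma wt_gt0_le i k j : (i <= k)%N -> 0 < wt k j -> 0 < wt i j.
Proof.
move=> ik; rewrite !(wt_gt0P p_rec p_ge0 p_mom K_ge2) => /andP[pj pk].
rewrite pj /=; apply: (supp_interval p_rec p_ge0 p_mom K_ge2 _ _ pj pk); lia.
Qed.

Lemma tot_wt_gt0 m : (2 * m <= K)%N -> (exists j, 0 < wt m j) -> 0 < tot (wt m).
Proof.
move=> mK [j wj]; apply: lt_le_trans wj _; apply: le_tot_term => //.
exact: (sbl_wt1 _ _ _ p_mom K_ge2).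
Qed.

Lemma A_wt m : (2 * m <= K)%N -> A_ X q m = tot (wt m).
Proof. by move=> mK; rewrite /A_ Ex_tot //; exact: (sbl_wt1 _ _ _ p_mom K_ge2). Qed.

Lemma phi_mul_ipmf m j : phi X delta q m j * p j =
  (Num.sqrt (m`!%:R * c_ delta m * A_ X q m))^-1 * ((rodpoly m 0).[j%:~R] * wt 0 j).
Proof.
rewrite /phi -[LHS]mulrA; congr (_ * _).
rewrite (@rodrigues_mul_pmf _ _ _ _ _ _ p_rec p q 0 m 1 1) ?mul1r // => l.
by rewrite mul1r wt0.
by rewrite mul1r.
Qed.

Lemma Pi_wt_gt0 k n m : (2 * k <= K)%N -> (exists j, 0 < wt k j) ->
  (n + m <= (2 * k).-1)%N -> 0 < Pi_ delta n m.
Proof.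
move=> kK [j wj]; case: k => [|k] in kK wj *.
  by rewrite leqn0 addn_eq0 => /andP[/eqP -> /eqP ->]; rewrite /Pi_ big_geq.
by move=> nm; apply: (Pi_gt0 p_rec p_ge0 p_mom K_ge2 kK wj); lia.
Qed.

Section shifted.
Context d' (T' : measurableType d') (P' : probability T' R) (Y : {RV P' >-> int}).
Variable i : nat.
Hypothesis iK : (2 * i <= K)%N.
Hypothesis Y_pmf : pmf_prop X q i Y.

Lemma pmf_propE j : ipmf Y j = (tot (wt i))^-1 * wt i j.
Proof.
have [c cE] := Y_pmf; have ws : sbl (wt i) by exact: (sbl_wt1 _ _ _ p_mom K_ge2).
have c1 : c * tot (wt i) = 1.
  by rewrite -totZ // -(tot_ipmf Y); congr tot; apply/funext => l; rewrite cE.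
have W0 : tot (wt i) != 0.
  by apply: contra_eq_neq c1 => ->; rewrite mulr0 eq_sym oner_neq0.
by rewrite cE; congr (_ * _); apply: (mulIf W0); rewrite c1 mulVf.
Qed.

Lemma rising_q_mul_ipmf m l : rising m (q_ delta q i) l * ipmf Y l =
  ((1 - 2 * i%:R * delta) ^+ m)^-1 * (tot (wt i))^-1 * wt (i + m) l.
Proof. by rewrite rising_q_ pmf_propE wtD; ring. Qed.

Lemma A_shifted m : (2 * (i + m) <= K)%N -> A_ Y (q_ delta q i) m =
  ((1 - 2 * i%:R * delta) ^+ m)^-1 * ((tot (wt i))^-1 * tot (wt (i + m))).
Proof.
move=> mK; have ws : sbl (wt (i + m)) by exact: (sbl_wt1 _ _ _ p_mom K_ge2).
have e : (fun j => rising m (q_ delta q i) j * ipmf Y j) =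
    (fun j => ((1 - 2 * i%:R * delta) ^+ m)^-1 * (tot (wt i))^-1 * wt (i + m) j).
  by apply/funext => j; rewrite rising_q_mul_ipmf.
rewrite /A_ Ex_tot e; last exact: sblZ.
by rewrite /= totZ // mulrA.
Qed.

Lemma phi_shifted_mul_ipmf m j : tot (wt i) != 0 ->
  phi Y (delta_ delta i) (q_ delta q i) m j * ipmf Y j =
  (Num.sqrt (m`!%:R * c_ (delta_ delta i) m * A_ Y (q_ delta q i) m))^-1 *
  (((1 - 2 * i%:R * delta) ^+ m)^-1 * (tot (wt i))^-1 *
   ((rodpoly m i).[j%:~R] * wt i j)).
Proof.
move=> W0; rewrite /phi; set N := Num.sqrt _; rewrite -[LHS]mulrA; congr (_ * _).
apply: (@rodrigues_mul_pmf _ _ _ _ _ _ p_rec (ipmf Y) (q_ delta q i) i m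
  (tot (wt i))^-1 (((1 - 2 * i%:R * delta) ^+ m)^-1 * (tot (wt i))^-1)).
- by rewrite invr_eq0.
- exact: pmf_propE.
- exact: rising_q_mul_ipmf.
Qed.

(** Both expectations are constants times sums that [rodpoly_parts] identifies, and [v_] is the
    quotient of the constants. *)
Lemma fourier_shift k g : (1 <= k)%N -> (2 * k <= K)%N -> leM k X -> (i <= k)%N ->
  let phi_i := phi Y (delta_ delta i) (q_ delta q i) (k - i) in
  has_Ex Y (fun j => phi_i j * fdiffn i g j) ->
  has_Ex X (fun j => phi X delta q k j * g j) /\
  Ex Y (fun j => phi_i j * fdiffn i g j) =
  ((v_ X delta q k i)%:E * Ex X (fun j => (phi X delta q k j * g j)%R))%E.
Proof.
move=> k1 kK /leM_wtP[j0 wj0] ik phi_i.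
have wex : exists j, 0 < wt k j by exists j0.
have Wk := tot_wt_gt0 kK wex.
have Wi : 0 < tot (wt i).
  by apply: tot_wt_gt0 => //; exists j0; exact: wt_gt0_le wj0.
set l := (1 - 2 * i%:R * delta) ^+ (k - i).
have lam : (k - i = 0)%N \/ 0 < 1 - 2 * i%:R * delta.
  move: ik; rewrite leq_eqVlt => /orP[/eqP ->|ik]; first by left; rewrite subnn.
  right; apply: (slope_gt0 p_rec p_ge0 p_mom K_ge2 _ (wt_gt0_le ik wj0)); lia.
have l0 : 0 < l.
  by rewrite /l; case: lam => [->|h]; rewrite ?expr0 // exprn_gt0.
have P1 : 0 < Pi_ delta i k.-1 by apply: (Pi_wt_gt0 kK wex); lia.
have P2 : 0 < Pi_ delta (k - i) ((k - i).-1 + 2 * i).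
  have [->|ki] := eqVneq k i; first by rewrite subnn /Pi_ big_geq.
  apply: (Pi_wt_gt0 kK wex); lia.
have kf : 0 < k`!%:R :> R by rewrite ltr0n fact_gt0.
have mf : 0 < (k - i)`!%:R :> R by rewrite ltr0n fact_gt0.
pose Ni := (k - i)`!%:R * c_ (delta_ delta i) (k - i) * A_ Y (q_ delta q i) (k - i).
pose Nk := k`!%:R * c_ delta k * A_ X q k.
have NiE : Ni = (k - i)`!%:R * (Pi_ delta (k - i) ((k - i).-1 + 2 * i) / l) *
    (l^-1 * ((tot (wt i))^-1 * tot (wt k))).
  by rewrite /Ni c_delta_ // A_shifted subnKC.
have NkE : Nk = k`!%:R * (Pi_ delta i k.-1 *
    Pi_ delta (k - i) ((k - i).-1 + 2 * i)) * tot (wt k).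
  by rewrite /Nk A_wt // /c_ (Pi_split _ ik).
have Ni0 : 0 < Ni by rewrite NiE !(mulr_gt0, divr_gt0) ?invr_gt0.
pose ci := (Num.sqrt Ni)^-1 * (l^-1 * (tot (wt i))^-1).
have ci0 : ci != 0.
  by rewrite !mulf_neq0 ?invr_neq0 // ?sqrtr_eq0 -?ltNge // lt0r_neq0.
have EY : (fun j => phi_i j * fdiffn i g j * ipmf Y j) =
    (fun j => ci * ((rodpoly (k - i) i).[j%:~R] * wt i j * fdiffn i g j)).
  apply/funext => j; rewrite mulrAC phi_shifted_mul_ipmf ?lt0r_neq0 //.
  by rewrite -/Ni -/l /ci; ring.
have EX : (fun j => phi X delta q k j * g j * p j) =
    (fun j => (Num.sqrt Nk)^-1 * ((rodpoly k 0).[j%:~R] * wt 0 j * g j)).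
  by apply/funext => j; rewrite mulrAC phi_mul_ipmf -/Nk; ring.
rewrite has_Ex_sbl EY => /(sblZ ci^-1) hs.
have {}hs : sbl (fun j =>
    (rodpoly (k - i) (0 + i)).[j%:~R] * wt (0 + i) j * fdiffn i g j).
  by apply: sbl_le hs _ => j; rewrite mulKf.
have [|s0 t0] := rodpoly_parts p_rec p_ge0 p_mom K_ge2 _ hs; first lia.
rewrite subnK // in s0 t0; rewrite !add0n in hs t0.
split; first by apply/has_Ex_sbl; rewrite EX; exact: sblZ.
rewrite !Ex_tot ?EX ?EY; [|exact: sblZ|exact: sblZ].
rewrite !totZ // t0 -EFinM mulrA; congr (_ * _)%:E.
rewrite /ci NiE NkE /v_ A_wt //; exact: fourier_constant.
Qed.

End shifted.
End CO_family.

(** * Part (b) *)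

Section fourier_expansion.
Context d (T : measurableType d) (R : realType) (P : probability T R).
Variables (X : {RV P >-> int}) (mu delta beta gamma : R).
Local Notation p := (ipmf X).
Local Notation wt := (wt delta beta gamma p).
Local Notation rodpoly := (rodpoly delta beta gamma mu).
Local Notation q := (quad delta beta gamma).
Hypothesis p_rec : forall j, (qpoly delta beta gamma).[j%:~R] * p j =
  (rpoly delta beta gamma mu).[(j + 1)%:~R] * p (j + 1).
Hypothesis p_mom : forall K, mom K p.
Hypothesis p_tails : forall i, exp_tails (wt i).
Variables (n : nat) (g : int -> R).
Hypothesis n_leM : leM n X.
Context d' (T' : measurableType d') (P' : probability T' R) (Y : {RV P' >-> int}).
Hypothesis Y_pmf : pmf_prop X q n Y.
Hypothesis g_L2 : in_L2 Y (fdiffn n g).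

Let p_ge0 := ipmf_ge0 X.

Let K2 i : (2 <= 2 * i + 2)%N.
Proof. by rewrite leq_addl. Qed.

Let w_ge0 i j : 0 <= wt i j.
Proof. exact: (wt_ge0 p_rec p_ge0 (p_mom _) (K2 0)). Qed.

Let leM_wt m : leM m X <-> exists j, 0 < wt m j.
Proof. exact: (leM_wtP p_rec (p_mom _) (K2 0)). Qed.

(** Downward induction from level [n], one Hardy inequality per level; the slopes are positive
    because [wt n] is not identically [0]. *)
Lemma sbl_diff_L2 i : (i <= n)%N -> sbl (fun j => wt i j * fdiffn i g j ^+ 2).
Proof.
have [j0 wj0] := (leM_wt n).1 n_leM.
have Wn : 0 < tot (wt n).
  apply: (tot_wt_gt0 p_rec (p_mom (2 * n + 2)%N) (K2 n)); first by lia.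
  by exists j0.
move=> i_n; have -> : i = (n - (n - i))%N by rewrite subKn.
have := leq_subr i n; elim: (n - i)%N => [_|r IH rn].
  rewrite subn0; have sY := Ex_lty_sbl (fun j => sqr_ge0 (fdiffn n g j)) g_L2.
  apply: sbl_le (sblZ (tot (wt n)) sY) _ => j.
  rewrite (pmf_propE (p_mom (2 * n + 2)%N) (K2 n) _ Y_pmf); last by lia.
  by rewrite [fdiffn n g j ^+ 2 * _]mulrC -[X in _ <= `|_ * X|]mulrA mulVKf // lt0r_neq0.
have e : (n - r = (n - r.+1).+1)%N by lia.
have {}IH := IH (ltnW rn); rewrite e in IH.
apply: (wt_hardy p_rec p_ge0 (p_mom (2 * n + 2)%N) (K2 n)) => //; first by lia.
apply: (slope_gt0 p_rec p_ge0 (p_mom (2 * n + 2)%N) (K2 n) (j := j0)); first by lia.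
by apply: (wt_gt0_le p_rec (p_mom (2 * n + 2)%N) (K2 n) _ wj0); lia.
Qed.

Lemma has_Ex_phi m : has_Ex X (fun j => phi X delta q m j * g j).
Proof.
apply/has_Ex_sbl.
have gs : sbl (fun j => wt 0 j * g j ^+ 2) by exact: (sbl_diff_L2 (leq0n n)).
have := sblZ (Num.sqrt (m`!%:R * c_ delta m * A_ X q m))^-1
  (sbl_poly_L2 p_rec p_ge0 p_mom gs (rodpoly m 0)).
congr sbl; apply/funext => j.
by rewrite [RHS]mulrAC (phi_mul_ipmf p_rec) mulrA.
Qed.

Lemma alphaE m : alpha X delta q g m =
  (Num.sqrt (m`!%:R * c_ delta m * A_ X q m))^-1 *
  tot (fun j => (rodpoly m 0).[j%:~R] * wt 0 j * g j).
Proof.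
have gs : sbl (fun j => wt 0 j * g j ^+ 2) by exact: (sbl_diff_L2 (leq0n n)).
rewrite /alpha Ex_tot /=; last exact/has_Ex_sbl/has_Ex_phi.
rewrite -totZ; last exact: (sbl_poly_L2 p_rec p_ge0 p_mom gs (rodpoly m 0)).
congr tot; apply/funext => j.
by rewrite [LHS]mulrAC (phi_mul_ipmf p_rec) [RHS]mulrA.
Qed.

(** Part (a) before normalization, with [m = k - i]. *)
Lemma fourier_diff i m : (i <= n)%N ->
  fourier delta beta gamma mu p i (fdiffn i g) m =
  tot (fun j => (rodpoly (m + i) 0).[j%:~R] * wt 0 j * g j).
Proof.
move=> i_n.
have hs := sbl_poly_L2 p_rec p_ge0 p_mom (sbl_diff_L2 i_n) (rodpoly m i).
have [|_ ->] // := @rodpoly_parts _ _ _ _ _ _ _ p_rec p_ge0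
  (p_mom (2 * (m + 2 * i) + 2)%N) (K2 _) m i 0 g _ hs.
by rewrite add0n; lia.
Qed.

(** By [Pi_split], the factor in front of [alpha] is the ratio of the squared norms of [R_{m+i,0}]
    at level [0] and [R_{m,i}] at level [i]; both contain the same [tot (wt (i + m))]. *)
Lemma expansion_term i m : (i <= n)%N -> leM (m + i) X ->
  (m + i)`!%:R * Pi_ delta i (m + i).-1 / m`!%:R * alpha X delta q g (m + i) ^+ 2 =
  fourier delta beta gamma mu p i (fdiffn i g) m ^+ 2 /
  rodnorm delta beta gamma mu p i m.
Proof.
move=> i_n /leM_wt wex; rewrite fourier_diff // alphaE.
have hK : (2 * (m + i) <= 2 * (m + i) + 2)%N by exact: leq_addr.
have mm := p_mom (2 * (m + i) + 2)%N.
rewrite (A_wt _ _ _ mm (K2 _) hK) (rodnormE p_rec p_ge0 p_mom).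
have W := tot_wt_gt0 p_rec mm (K2 _) hK wex.
have P1 : 0 < Pi_ delta i (m + i).-1.
  by apply: (Pi_wt_gt0 p_rec mm (K2 _) hK wex); lia.
have P2 : 0 < Pi_ delta m (m.-1 + 2 * i).
  case: (m) wex hK mm {W P1} => [|m'] wex hK mm; first by rewrite /Pi_ big_geq.
  by apply: (Pi_wt_gt0 p_rec mm (K2 _) hK wex); lia.
rewrite /c_ (Pi_split _ (leq_addl m i)) addnK [(i + m)%N]addnC.
have f1 : 0 < (m + i)`!%:R :> R by rewrite ltr0n fact_gt0.
have f2 : 0 < m`!%:R :> R by rewrite ltr0n fact_gt0.
rewrite exprMn exprVn sqr_sqrtr; last by rewrite !mulr_ge0 // ltW.
by field; rewrite !lt0r_neq0.
Qed.

Lemma rodnorm_eq0 i m : ~ leM (m + i) X -> rodnorm delta beta gamma mu p i m = 0.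
Proof.
move=> nM; rewrite (rodnormE p_rec p_ge0 p_mom) [tot _](_ : _ = 0) ?mulr0 //.
rewrite -[RHS](tot0 R); congr tot; apply/funext => j; apply/eqP.
rewrite eq_le w_ge0 andbT leNgt; apply/negP => wj; apply: nM; apply/leM_wt.
by exists j; rewrite addnC.
Qed.

Lemma fourier_expansion i : (i <= n)%N ->
  Ex X (fun j => rising i q j * fdiffn i g j ^+ 2) =
  (\sum_(i <= m <oo | `[< leM m X >])
     (m`!%:R * Pi_ delta i m.-1 / (m - i)`!%:R * alpha X delta q g m ^+ 2)%:E)%E /\
  (Ex X (fun j => (rising i q j * fdiffn i g j ^+ 2)%R) < +oo)%E.
Proof.
move=> i_n; have hs := sbl_diff_L2 i_n.
pose S N : R := \sum_(m < N) fourier delta beta gamma mu p i (fdiffn i g) m ^+ 2 /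
  rodnorm delta beta gamma mu p i m.
pose t m : R := m`!%:R * Pi_ delta i m.-1 / (m - i)`!%:R * alpha X delta q g m ^+ 2.
(* The index is shifted by [i]. The filter disappears because [rodnorm] is [0] beyond [M] and
   dividing by it yields [0]. *)
have SE N : \sum_(i <= m < N + i | `[< leM m X >]) t m = S N.
  rewrite /S -[X in \sum_(X <= _ < _ | _) _]add0n big_addn addnK big_mkord big_mkcond.
  apply: eq_bigr => m _; case: asboolP => mM.
    by rewrite -expansion_term // /t addnK.
  by rewrite rodnorm_eq0 // invr0 mulr0.
have EX : Ex X (fun j => rising i q j * fdiffn i g j ^+ 2) =
    (tot (fun j => wt i j * fdiffn i g j ^+ 2))%:E.
  have e : (fun j => rising i q j * fdiffn i g j ^+ 2 * p j) =
      (fun j => wt i j * fdiffn i g j ^+ 2).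
    by apply/funext => j; rewrite mulrAC.
  by rewrite Ex_tot e.
split; last by rewrite EX ltry.
have t0 m : `[< leM m X >] -> (i <= m)%N -> 0 <= t m.
  move=> /asboolP mM im; have := @expansion_term i (m - i) i_n.
  rewrite subnK // /t => ->//.
  by rewrite divr_ge0 ?sqr_ge0 // (rodnorm_ge0 p_rec p_ge0 p_mom).
have t0E m : (i <= m)%N -> `[< leM m X >] -> (0 <= (t m)%:E)%E.
  by move=> im mM; rewrite lee_fin t0.
(* [parseval] bounds the expectation by a partial sum plus [e]; [bessel] bounds every partial sum by
   the expectation. *)
rewrite EX; apply/eqP; rewrite eq_le; apply/andP; split.
  apply/lee_addgt0Pr => e e0.
  have wi : exists j, 0 < wt i j.
    have [j0 wj0] := (leM_wt n).1 n_leM; exists j0.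
    exact: (wt_gt0_le p_rec (p_mom _) (K2 0) i_n wj0).
  have [N hN] := parseval p_rec p_ge0 p_mom hs (p_tails i) wi e0.
  apply: (@le_trans _ _ ((S N)%:E + e%:E)%E); first by rewrite -EFinD lee_fin.
  rewrite leeD2r // -SE -sumEFin; exact: nneseries_lim_ge.
apply: lime_le; first exact: is_cvg_nneseries.
near=> N; rewrite sumEFin lee_fin.
have iN : (i <= N)%N by near: N; exact: nbhs_infty_ge.
by rewrite -(subnK iN) SE; exact: (bessel p_rec p_ge0 p_mom hs).
Unshelve. all: by end_near.
Qed.

End fourier_expansion.

Theorem theorem8p8 (R : realType)
    (d : measure_display) (T : measurableType d) (P : probability T R)
    (X : {RV P >-> int}) (mu delta beta gamma : R)
    (X_CO : CO X mu (quad delta beta gamma))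
    (g : int -> R)
    (k : nat) (k_ge1 : (1 <= k)%N) (k_leM : leM k X)
    (X_mom : (Ex X (fun j => (`|j%:~R| ^+ (2 * k + 1)%N)%R) < +oo)%E)
    (d_ : nat -> measure_display) (T_ : forall i : nat, measurableType (d_ i))
    (P_ : forall i : nat, probability (T_ i) R)
    (X_ : forall i : nat, {RV (P_ i) >-> int})
    (X_pmf : forall i : nat, (i <= k)%N ->
       pmf_prop X (quad delta beta gamma) i (X_ i)) :
  let q := quad delta beta gamma in
  (forall i : nat, (i <= k)%N ->
     let phi_i := phi (X_ i) (delta_ delta i) (q_ delta q i) (k - i) in
     has_Ex (X_ i) (fun j => phi_i j * fdiffn i g j) ->
     has_Ex X (fun j => phi X delta q k j * g j) /\
     Ex (X_ i) (fun j => phi_i j * fdiffn i g j) =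
       ((v_ X delta q k i)%:E * Ex X (fun j => (phi X delta q k j * g j)%R))%E)
  /\
  (delta <= 0 \/ finite_set (supp X) ->
   forall n : nat, (1 <= n)%N -> leM n X ->
     pmf_prop X q n (X_ n) ->
     in_L2 (X_ n) (fdiffn n g) ->
     (forall m : nat, leM m X -> has_Ex X (fun j => phi X delta q m j * g j)) /\
     (forall i : nat, (i <= n)%N ->
        (Ex X (fun j => (rising i q j * fdiffn i g j ^+ 2)%R) < +oo)%E /\
        Ex X (fun j => rising i q j * fdiffn i g j ^+ 2) =
          (\sum_(i <= m <oo | `[< leM m X >])
             (m`!%:R * Pi_ delta i m.-1 / (m - i)`!%:R
              * alpha X delta q g m ^+ 2)%R%:E)%E)).
Proof.
move=> q.
have p_rec := CO_recurrence X_CO.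
have p_ge0 := ipmf_ge0 X.
have K2 : (2 <= 2 * k + 1)%N by lia.
have p_mom : mom (2 * k + 1) (ipmf X).
  split; first exact: sbl_ipmf.
  by apply: Ex_lty_sbl X_mom => j; rewrite exprn_ge0.
split=> [i ik phi_i h|dS n n1 n_leM Y_pmf g_L2].
  by apply: (fourier_shift p_rec p_mom K2 _ (X_pmf i ik)) => //; lia.
have tails i : exp_tails (wt delta beta gamma (ipmf X) i).
  apply: (wt_exp_tails p_rec p_ge0 p_mom K2).
  case: dS => [|/finite_set_int_bounded [N HN]]; first by left.
  right; exists N => j Nj; apply/eqP; rewrite eq_le p_ge0 andbT leNgt.
  by apply/negP => /HN; rewrite ltNge Nj.
(* Part (b) uses polynomials of unbounded degree; the geometric tails supply moments of every
   order. *)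
have moms K : mom K (ipmf X).
  have := exp_tails_mom K (fun j => wt_ge0 p_rec p_ge0 p_mom K2 0 j) (tails 0%N).
  by congr mom; apply/funext => j; rewrite wt0.
split=> [m _|i i_n].
  exact: (has_Ex_phi p_rec moms n_leM Y_pmf g_L2).
by have [? ?] := fourier_expansion p_rec moms tails n_leM Y_pmf g_L2 i_n.
Qed.
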